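(* Let $X$ be a locally compact Hausdorff space, let $\mathcal{H}$ be a finite-dimensional complex Hilbert space, and let $\nu_1,\nu_2\in\mathrm{POVM}^1_{\mathcal{H}}(X)$ satisfy $\nu_2\ll_{\rm ac}\nu_1$ and $\nu_1\ll_{\rm ac}\nu_2$. If $\psi:X\to\mathcal{B}(\mathcal{H})_+$ is a ($\nu_2$-integrable) quantum random variable with $\mathbb{E}_{\nu_2}[\psi]\ne0$ and $\mathcal{F}(X)$ is a sub-$\sigma$-algebra of $\mathcal{O}(X)$, then $$\mathbb{E}_{\nu_2}[\psi\,|\,\mathcal{F}(X)]\boxtimes\mathbb{E}_{\nu_1}\left[\frac{\mathrm{d}\nu_2}{\mathrm{d}\nu_1}\,\bigg|\,\mathcal{F}(X)\right]=\mathbb{E}_{\nu_1}\left[\psi\boxtimes\frac{\mathrm{d}\nu_2}{\mathrm{d}\nu_1}\,\bigg|\,\mathcal{F}(X)\right]$$ (equality up to sets of $\nu_1$-measure zero).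
   Context: Let $d=\dim\mathcal{H}$; $\mathcal{O}(X)$ is the Borel $\sigma$-algebra of $X$; $\mathcal{B}(\mathcal{H})_+$ is the cone of positive operators. A state is a positive operator $\rho$ with $\operatorname{Tr}(\rho)=1$. For a $\sigma$-algebra $\mathcal{F}(X)$ on $X$, a positive operator valued measure on $(X,\mathcal{F}(X))$ is a function $\nu:\mathcal{F}(X)\to\mathcal{B}(\mathcal{H})$ with $\nu(E)\in\mathcal{B}(\mathcal{H})_+$, $\nu(X)\ne0$, countably additive on pairwise disjoint families ($\sigma$-weak convergence); $\mathrm{POVM}^1_{\mathcal{H}}(X)$ is the set of those on $\mathcal{O}(X)$ with $\nu(X)=1$. $\nu_2\ll_{\rm ac}\nu_1$ means $\nu_2(E)=0$ whenever $\nu_1(E)=0$. A function $\psi:X\to\mathcal{B}(\mathcal{H})$ is $\mathcal{F}(X)$-measurable if $x\mapsto\operatorname{Tr}(\rho\psi(x))$ is $\mathcal{F}(X)$-measurable for every state $\rho$; a quantum random variable is such a function (with $\mathcal{F}(X)=\mathcal{O}(X)$ unless stated otherwise). For a positive operator valued measure $\nu$ on $(X,\mathcal{F}(X))$, $\mu_\nu=\frac1d\operatorname{Tr}\circ\nu$, and $\mathrm{d}\nu/\mathrm{d}\mu_\nu:X\to\mathcal{B}(\mathcal{H})_+$ is the $\mathcal{F}(X)$-measurable Radon-Nikodým derivative: $\nu(E)=\int_E\frac{\mathrm{d}\nu}{\mathrm{d}\mu_\nu}\,\mathrm{d}\mu_\nu$ for all $E\in\mathcal{F}(X)$. $\psi$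 is $\nu$-integrable if for every state $\rho$ the function $\psi_\rho=\operatorname{Tr}\left(\rho\left(\frac{\mathrm{d}\nu}{\mathrm{d}\mu_\nu}\right)^{1/2}\psi\left(\frac{\mathrm{d}\nu}{\mathrm{d}\mu_\nu}\right)^{1/2}\right)$ is $\mu_\nu$-integrable; then $\mathbb{E}_\nu[\psi]=\int_X\psi\,\mathrm{d}\nu$ is the unique operator with $\operatorname{Tr}(\rho\int_X\psi\,\mathrm{d}\nu)=\int_X\psi_\rho\,\mathrm{d}\mu_\nu$ for every state $\rho$; $\int_E\psi\,\mathrm{d}\nu=\int_X\chi_E\psi\,\mathrm{d}\nu$. For $a\in\mathcal{B}(\mathcal{H})_+$, $a^{-1}$ denotes the generalised inverse $\sum_{\lambda_k\ne0}\lambda_k^{-1}p_k$, where $a=\sum_k\lambda_kp_k$ is the spectral decomposition. For positive operator valued measures $\nu_2\ll_{\rm ac}\nu_1$ on $(X,\mathcal{F}(X))$, with $\mu_j=\mu_{\nu_j}$, the Radon-Nikodým derivative $\frac{\mathrm{d}\nu_2}{\mathrm{d}\nu_1}$ is the bounded $\nu_1$-integrable $\mathcal{F}(X)$-measurable $\varphi$ with $\nu_2(E)=\int_E\varphi\,\mathrm{d}\nu_1$ for all $E\in\mathcal{F}(X)$; the paper cites a Radon-Nikodým theorem according to which such $\varphi$ exists, is unique up to sets of $\nu_1$-measure zero, and is given by $\varphi=\frac{\mathrm{d}\mu_2}{\mathrm{d}\mu_1}\left[\left(\frac{\mathrm{d}\nu_1}{\mathrm{d}\mu_1}\right)^{-1/2}\frac{\mathrm{d}\nu_2}{\mathrm{d}\mu_2}\left(\frac{\mathrm{d}\nu_1}{\mathrm{d}\mu_1}\right)^{-1/2}\right]$.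 Geometric mean: for invertible $a,b\in\mathcal{B}(\mathcal{H})_+$, $a\mathbin{\#}b=a^{1/2}(a^{-1/2}ba^{-1/2})^{1/2}a^{1/2}$; for non-invertible $a,b$, $a\mathbin{\#}b=\lim_{\varepsilon\to0+}(a+\varepsilon1)\mathbin{\#}(b+\varepsilon1)$ (strong operator topology). Definition of $\boxtimes$: $$\psi\boxtimes\frac{\mathrm{d}\nu_2}{\mathrm{d}\nu_1}=\left(\left(\frac{\mathrm{d}\nu_1}{\mathrm{d}\mu_1}\right)^{-1}\mathbin{\#}\frac{\mathrm{d}\nu_2}{\mathrm{d}\nu_1}\right)\left(\frac{\mathrm{d}\nu_1}{\mathrm{d}\mu_1}\right)^{1/2}\psi\left(\frac{\mathrm{d}\nu_1}{\mathrm{d}\mu_1}\right)^{1/2}\left(\left(\frac{\mathrm{d}\nu_1}{\mathrm{d}\mu_1}\right)^{-1}\mathbin{\#}\frac{\mathrm{d}\nu_2}{\mathrm{d}\nu_1}\right).$$ Quantum conditional expectation: for $\nu\in\mathrm{POVM}^1_{\mathcal{H}}(X)$, a $\nu$-integrable quantum random variable $\psi:X\to\mathcal{B}(\mathcal{H})_+$ with $\mathbb{E}_\nu[\psi]\ne0$ and a sub-$\sigma$-algebra $\mathcal{F}(X)$ of $\mathcal{O}(X)$, $\mathbb{E}_\nu[\psi\,|\,\mathcal{F}(X)]$ is the function $\varphi:X\to\mathcal{B}(\mathcal{H})$ (versions differing on a $\nu$-null set are identified) that is $\mathcal{F}(X)$-measurable, $\nu$-integrable and satisfies $\mathbb{E}_\nu[\psi\chi_E]=\mathbb{E}_\nu[\varphi\chi_E]$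 for every $E\in\mathcal{F}(X)$. In the paper it is identified with the Radon-Nikodým derivative $\mathrm{d}\tilde\nu/\mathrm{d}\nu'$, where $\nu'=\nu|_{\mathcal{F}(X)}$ and $\tilde\nu(E)=\int_E\psi\,\mathrm{d}\nu$ for $E\in\mathcal{F}(X)$. On the left-hand side of the claimed identity, with $\nu_j'=\nu_j|_{\mathcal{F}(X)}$ and $\mu_j'=\mu_{\nu_j'}=\frac1d\operatorname{Tr}\circ\nu_j'$, the factor $\mathbb{E}_{\nu_1}[\frac{\mathrm{d}\nu_2}{\mathrm{d}\nu_1}\,|\,\mathcal{F}(X)]$ is the Radon-Nikodým derivative $\frac{\mathrm{d}\nu_2'}{\mathrm{d}\nu_1'}$, and $\boxtimes$ is the operation for the pair $\nu_1',\nu_2'$ on $(X,\mathcal{F}(X))$ given, for $\mathcal{F}(X)$-measurable $\eta:X\to\mathcal{B}(\mathcal{H})$, by $$\eta\boxtimes\frac{\mathrm{d}\nu_2'}{\mathrm{d}\nu_1'}=\left(\left(\frac{\mathrm{d}\nu_1'}{\mathrm{d}\mu_1'}\right)^{-1}\mathbin{\#}\frac{\mathrm{d}\nu_2'}{\mathrm{d}\nu_1'}\right)\left(\frac{\mathrm{d}\nu_1'}{\mathrm{d}\mu_1'}\right)^{1/2}\eta\left(\frac{\mathrm{d}\nu_1'}{\mathrm{d}\mu_1'}\right)^{1/2}\left(\left(\frac{\mathrm{d}\nu_1'}{\mathrm{d}\mu_1'}\right)^{-1}\mathbin{\#}\frac{\mathrm{d}\nu_2'}{\mathrm{d}\nu_1'}\right),$$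 applied with $\eta=\mathbb{E}_{\nu_2}[\psi\,|\,\mathcal{F}(X)]$.
   Formalization: The Radon–Nikodým derivative of ν₂ with respect to ν₁ is assumed to exist, given a.e. by the closed formula, boundedness not required: mutual absolute continuity does not ensure it, e.g. ν₁=(p,1−p), ν₂=(q,1−q) on two points with distinct non-orthogonal rank-one projections p, q. *)

(* Defs.v *)
From HB Require Import structures.
From mathcomp Require Import all_boot all_order all_algebra.
From mathcomp Require Import all_classical all_reals all_analysis.
From mathcomp.real_closed Require Import complex.
From mathcomp Require Import sesquilinear spectral.

Set Implicit Arguments.
Unset Strict Implicit.
Unset Printing Implicit Defensive.

Import Order.TTheory GRing.Theory Num.Theory numFieldNormedType.Exports.

Local Open Scope classical_set_scope.
Local Open Scope complex_scope.
Local Open Scope sesquilinear_scope.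
Local Open Scope ring_scope.

(* Operators on a d-dimensional complex Hilbert space are d x d matrices over
   R[i] (in an orthonormal basis).  The dimension d is arbitrary; d = 0 is
   excluded by [is_povm], which asks for a nonzero total mass. *)

Section operators.
Context {R : realType} {d : nat}.
Implicit Types a b rho : 'M[R[i]]_d.

(* On R[i], 0 <= z means that z is real and nonnegative; over the complex
   field this forces a to be Hermitian. *)
Definition psd a := forall v : 'cV[R[i]]_d, 0 <= (v ^t* *m a *m v) 0 0.

Definition state rho := psd rho /\ \tr rho = 1.

(* f(a) by the spectral decomposition of a normal matrix a. *)
Definition spectral_fun (f : R[i] -> R[i]) a : 'M[R[i]]_d :=
  invmx (spectralmx a) *m diag_mx (map_mx f (spectral_diag a))
    *m spectralmx a.

Definition sqrtm a := spectral_fun sqrtC a.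

(* Generalised inverse: 0^-1 = 0 in R[i], so only the nonzero eigenvalues are
   inverted. *)
Definition ginv a := spectral_fun (fun z => z^-1) a.

Definition geomean_inv a b : 'M[R[i]]_d :=
  let s := sqrtm a in let t := ginv s in
  s *m sqrtm (t *m b *m t) *m s.

(* If a or b is singular, a # b is the limit in the strong operator topology of
   (a + e) # (b + e) as e -> 0+.  The annotations R[i]^o give access to the
   norm topology of R[i]. *)
Definition geomean a b : 'M[R[i]]_d :=
  if (a \in unitmx) && (b \in unitmx) then geomean_inv a b
  else xget 0 [set m | forall v : 'cV[R[i]]_d,
    (geomean_inv (a + (e%:C)%:M) (b + (e%:C)%:M) *m v : 'cV[R[i]^o]_d)
      @[e --> 0^'+] --> (m *m v : 'cV[R[i]^o]_d)].

(* The product of psi and d nu2 / d nu1, where A is d nu1 / d mu_nu1 and phi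
   is d nu2 / d nu1. *)
Definition boxtimes {X : Type} (A phi psi : X -> 'M[R[i]]_d) (x : X) :
  'M[R[i]]_d :=
  geomean (ginv (A x)) (phi x) *m sqrtm (A x) *m psi x *m sqrtm (A x)
    *m geomean (ginv (A x)) (phi x).

End operators.

Section complex_integral.
Context {R : realType} {disp : measure_display} {T : measurableType disp}.
Implicit Types (mu : set T -> \bar R) (f : T -> R[i]).

Definition cmeasurable f :=
  measurable_fun [set: T] (fun x => complex.Re (f x)) /\
  measurable_fun [set: T] (fun x => complex.Im (f x)).

Definition cintegrable mu f :=
  mu.-integrable [set: T] (fun x => (complex.Re (f x))%:E) /\
  mu.-integrable [set: T] (fun x => (complex.Im (f x))%:E).

Definition cintegral mu (E : set T) f : R[i] :=
  fine (\int[mu]_(x in E) (complex.Re (f x))%:E)%E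
  +i* fine (\int[mu]_(x in E) (complex.Im (f x))%:E)%E.

End complex_integral.

(* A positive operator valued measure on a measurable space T is represented by
   a function on all subsets of T, of which only the values on measurable sets
   matter.  In this way the restriction of nu to a sub-sigma-algebra F is nu
   itself, seen on g_sigma_algebraType F.  The space T is an explicit argument
   below, since it records which sigma-algebra is meant. *)
Section povm.
Context {R : realType} {d : nat} {disp : measure_display}.
Variable T : measurableType disp.
Implicit Types (nu : set T -> 'M[R[i]]_d) (E : set T).
Implicit Types (psi phi A : T -> 'M[R[i]]_d).

(* Sigma-weak convergence is tested against all (trace class) operators rho. *)
Definition is_povm nu :=
  [/\ forall E, measurable E -> psd (nu E),
      nu [set: T] <> 0 &
      forall E : nat -> set T, (forall k, measurable (E k)) ->
        trivIset [set: nat] E ->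
        forall rho : 'M[R[i]]_d,
          ((\sum_(k < n) \tr (rho *m nu (E k))) : R[i]^o) @[n --> \oo]
            --> (\tr (rho *m nu (\bigcup_k E k)) : R[i]^o)].

Definition is_povm1 nu := is_povm nu /\ nu [set: T] = 1%:M.

Definition povm_ac nu2 nu1 :=
  forall E, measurable E -> nu1 E = 0 -> nu2 E = 0.

Definition povm_ae nu (P : T -> Prop) :=
  exists N, [/\ measurable N, nu N = 0 & forall x, ~ P x -> N x].

(* mu_nu = (1/d) Tr o nu, extended by 0 to nonmeasurable sets. *)
Definition trace_measure nu : set T -> \bar R := fun E =>
  if `[< measurable E >] then (complex.Re (\tr (nu E)) / d%:R)%:E else 0%E.

Definition qmeasurable psi :=
  forall rho, state rho -> cmeasurable (fun x => \tr (rho *m psi x)).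

(* A is a version of d nu / d mu_nu; the matrix-valued integral with respect to
   the scalar measure mu_nu is taken entrywise. *)
Definition is_density nu A :=
  [/\ forall x, psd (A x),
      qmeasurable A,
      forall i j, cintegrable (trace_measure nu) (fun x => A x i j) &
      forall E, measurable E ->
        nu E = \matrix_(i, j)
          cintegral (trace_measure nu) E (fun x => A x i j)].

(* In the next four definitions A stands for (a version of) d nu / d mu_nu. *)
Definition qdensity A psi rho (x : T) : R[i] :=
  \tr (rho *m (sqrtm (A x) *m psi x *m sqrtm (A x))).

Definition qintegrable nu A psi :=
  forall rho, state rho -> cintegrable (trace_measure nu) (qdensity A psi rho).

Definition qexp nu A psi : 'M[R[i]]_d :=
  xget 0 [set m | forall rho, state rho ->
    \tr (rho *m m) = cintegral (trace_measure nu) [set: T]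
                       (qdensity A psi rho)].

Definition qintegral nu A E psi : 'M[R[i]]_d :=
  qexp nu A (fun x => (\1_E x)%:C *: psi x).

(* f is a version of the scalar derivative d mu_nu2 / d mu_nu1. *)
Definition is_trace_deriv nu1 nu2 (f : T -> R) :=
  [/\ forall x, 0 <= f x,
      measurable_fun [set: T] f &
      forall E, measurable E -> trace_measure nu2 E =
        (\int[trace_measure nu1]_(x in E) (f x)%:E)%E].

(* phi is a version of d nu2 / d nu1, where A1 is a version of
   d nu1 / d mu_nu1.  The integral identity determines phi only between the
   ranges of A1 (x), hence not almost everywhere when A1 (x) is singular; the
   closed formula of the last clause singles out the derivative.  The two
   conditions are independent: the closed formula satisfies the integral
   identity only if the range of d nu2 / d mu_nu2 lies almost everywhere in
   that of A1.  Boundedness of phi is not required. *)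
Definition is_qRN nu1 A1 nu2 phi :=
  [/\ qmeasurable phi,
      qintegrable nu1 A1 phi,
      forall E, measurable E -> nu2 E = qintegral nu1 A1 E phi &
      exists A2 f, [/\ is_density nu2 A2, is_trace_deriv nu1 nu2 f &
        povm_ae nu1 (fun x => phi x = (f x)%:C *:
          (ginv (sqrtm (A1 x)) *m A2 x *m ginv (sqrtm (A1 x))))]].

End povm.

Arguments is_povm {R d disp} T nu.
Arguments is_povm1 {R d disp} T nu.
Arguments povm_ac {R d disp} T nu2 nu1.
Arguments povm_ae {R d disp} T nu P.
Arguments trace_measure {R d disp} T nu.
Arguments qmeasurable {R d disp} T psi.
Arguments is_density {R d disp} T nu A.
Arguments qintegrable {R d disp} T nu A psi.
Arguments qexp {R d disp} T nu A psi.
Arguments qintegral {R d disp} T nu A E psi.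
Arguments is_trace_deriv {R d disp} T nu1 nu2 f.
Arguments is_qRN {R d disp} T nu1 A1 nu2 phi.

Notation Borel X := (g_sigma_algebraType (@open X)).

Section conditional_expectation.
Context {R : realType} {d : nat} {X : ptopologicalType}.
Variable F : set (set X).
Implicit Types (nu : set X -> 'M[R[i]]_d) (psi phi A AF : X -> 'M[R[i]]_d).

(* phi is a version of E_nu[psi | F], where A and AF are the densities of nu and
   of nu' = nu|F.  It is the Radon-Nikodym derivative with respect to nu' of
   the measure E |-> \int_E psi d nu on F: phi is F-measurable, nu'-integrable,
   and \int_E phi d nu' = \int_E psi d nu for all E in F.  The integral of the
   F-measurable function phi is thus taken on (X, F, nu'), with the density AF,
   and not with the density A of nu, which would give another operator because
   the square root does not commute with averaging over F. *)
Definition is_qcondexp nu A AF psi phi :=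
  [/\ forall x, psd (psi x),
      qmeasurable (Borel X) psi,
      qintegrable (Borel X) nu A psi,
      qexp (Borel X) nu A psi <> 0 &
      is_qRN (g_sigma_algebraType F) nu AF
        (fun E => qintegral (Borel X) nu A E psi) phi].

End conditional_expectation.

(* Main.v *)
Require Import Defs.
From HB Require Import structures.
From mathcomp Require Import all_boot all_order all_algebra.
From mathcomp Require Import all_classical all_reals all_analysis.
From mathcomp Require Import measurable_realfun.
From mathcomp.real_closed Require Import complex.
From mathcomp Require Import sesquilinear spectral ring.

Set Implicit Arguments.
Unset Strict Implicit.
Unset Printing Implicit Defensive.

Import Order.TTheory GRing.Theory Num.Theory numFieldNormedType.Exports.

Local Open Scope classical_set_scope.
Local Open Scope complex_scope.
Local Open Scope sesquilinear_scope.
Local Open Scope ring_scope.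

(** The two sides are compared through their integrals, and both turn out to be
    derivatives of one operator valued measure.

    Write a, b for the densities of nu1, nu2 with respect to their trace measures
    mu1, mu2, and f = d mu2 / d mu1.  The integral of phi against nu1 has the
    density a^(1/2) phi a^(1/2) with respect to mu1, while nu2 has the density f b.
    So a^(1/2) phi a^(1/2) = f b almost everywhere, phi lives on the range of a,
    and the geometric mean of a^-1 with phi is

      a^-1 # phi = a^(-1/2) (f b)^(1/2) a^(-1/2)

    with generalised inverses ([geomean_formula], which goes through the limit
    [gmean_sing]).  Substituting, boxtimes is f a^(-1/2) b^(1/2) psi b^(1/2) a^(-1/2),
    and sandwiching it by a^(1/2) gives f b^(1/2) psi b^(1/2) ([boxtimes_ae]).  In
    other words, the quantum integral of boxtimes against nu1 is the quantum
    integral of psi against nu2, over every measurable set; call it kappa.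

    This computation is valid for the Borel sets and, with the averaged
    derivatives, for F.  Over the Borel sets it says that the right-hand side is the
    derivative d kappa / d nu1 on F.  Over F, where the conditional expectation eta
    satisfies b'^(1/2) eta b'^(1/2) = (d mu_kappa / d mu2') B with B the density of
    kappa, it says that the left-hand side is (d mu_kappa / d mu1') a'^(-1/2) B
    a'^(-1/2), by the chain rule for the scalar derivatives.  That is the closed
    formula for d kappa / d nu1.  Uniqueness of densities gives the equality
    ([mxdensity_unique]).

    The conditional expectation of boxtimes exists only if boxtimes is measurable
    and positive at every point, including the null set where phi is not tied to a.
    There the mean is a limit along e -> 0+, and its existence is what makes it
    measurable ([mxmeas_geomean]).  It exists because the mean is monotone in both
    arguments ([gmean_mono]), by Loewner's theorem for the square root
    ([sqr_mono]).  Measurability of the square root itself comes from the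
    Babylonian iteration ([mxmeas_sqrtmx]), which avoids any measurable choice of
    eigenvectors. *)

(** * Adjoints and quadratic forms *)

Section adjoints.
Context {C : numClosedFieldType}.

Lemma adjmxM m n p (A : 'M[C]_(m, n)) (B : 'M[C]_(n, p)) :
  (A *m B)^t* = B^t* *m A^t*.
Proof. by rewrite trmx_mul map_mxM. Qed.

Lemma adjmxD m n (A B : 'M[C]_(m, n)) : (A + B)^t* = A^t* + B^t*.
Proof. by rewrite linearD map_mxD. Qed.

Lemma adjmxB m n (A B : 'M[C]_(m, n)) : (A - B)^t* = A^t* - B^t*.
Proof. by rewrite linearB map_mxB. Qed.

Lemma adjmxZ m n (c : C) (A : 'M[C]_(m, n)) : (c *: A)^t* = c^*%R *: A^t*.
Proof. by rewrite linearZ map_mxZ. Qed.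

Lemma adjmx_scalar n (c : C) : (c%:M : 'M[C]_n)^t* = (c^*%R)%:M.
Proof. by rewrite tr_scalar_mx map_scalar_mx. Qed.

Variable d : nat.
Implicit Types (a b q p X Y H : 'M[C]_d) (v w : 'cV[C]_d).

Definition sform a v w : C := (v^t* *m a *m w) 0 0.

Lemma sformDl a v v' w : sform a (v + v') w = sform a v w + sform a v' w.
Proof. by rewrite /sform adjmxD !mulmxDl mxE. Qed.

Lemma sformDr a v w w' : sform a v (w + w') = sform a v w + sform a v w'.
Proof. by rewrite /sform mulmxDr mxE. Qed.

Lemma sformZl a (c : C) v w : sform a (c *: v) w = c^*%R * sform a v w.
Proof. by rewrite /sform adjmxZ -!scalemxAl mxE. Qed.

Lemma sformZr a (c : C) v w : sform a v (c *: w) = c * sform a v w.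
Proof. by rewrite /sform -scalemxAr mxE. Qed.

Definition qform a v : C := sform a v v.

Lemma qformD a b v : qform (a + b) v = qform a v + qform b v.
Proof. by rewrite /qform /sform mulmxDr mulmxDl mxE. Qed.

Lemma qformN a v : qform (- a) v = - qform a v.
Proof. by rewrite /qform /sform mulmxN mulNmx mxE. Qed.

Lemma qformB a b v : qform (a - b) v = qform a v - qform b v.
Proof. by rewrite qformD qformN. Qed.

Lemma qform_congr a X v : qform (X^t* *m a *m X) v = qform a (X *m v).
Proof. by rewrite /qform /sform adjmxM !mulmxA. Qed.

Lemma qform_adj a v : qform (a^t*) v = (qform a v)^*%R.
Proof.
have -> : qform (a^t*) v = ((v^t* *m a *m v)^t*) 0 0.
  by rewrite /qform /sform !adjmxM trmxCK mulmxA.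
by rewrite mxE [in LHS]mxE.
Qed.

(** The left slot is antilinear, so the four values below recover [sform] from
    its diagonal; this is how limits and vanishing of quadratic forms pass to
    matrix entries. *)
Lemma polarization a v w :
  sform a v w *+ 4 =
    qform a (v + w) - qform a (v + -1 *: w)
    - 'i * qform a (v + 'i *: w) + 'i * qform a (v + - 'i *: w).
Proof.
rewrite /qform.
rewrite !(sformDl, sformDr, sformZl, sformZr) !rmorphN rmorph1 /= !conjCi.
have ii : 'i * 'i = -1 :> C by rewrite -expr2 sqrCi.
move: (sform a v v) (sform a v w) (sform a w v) (sform a w w) ii => x y z t.
move: ('i : C) => j ii.
ring: ii.
Qed.

Lemma mx_entryE a i j :
  a i j = sform a (delta_mx i 0) (delta_mx j 0).
Proof.
rewrite /sform; have -> : (delta_mx i 0 : 'cV[C]_d)^t* = delta_mx 0 i.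
  by rewrite trmx_delta map_delta_mx.
by rewrite -rowE -colE !mxE.
Qed.

Lemma qform_eq0 a : (forall v, qform a v = 0) -> a = 0.
Proof.
move=> a0; apply/matrixP => i j; rewrite [a i j]mx_entryE [RHS]mxE.
have /eqP := polarization a (delta_mx i 0) (delta_mx j 0).
by rewrite !a0 !mulr0 !subr0 addr0 mulrn_eq0 => /eqP.
Qed.

End adjoints.

(** * Positive operators and functional calculus *)

(** The spectral calculus f(a) over any algebraically closed number field.  It
    is locked because matrix products would otherwise unify with its body: the
    body is itself a product of three matrices. *)
HB.lock Definition sfun (C : numClosedFieldType) (d : nat) (f : C -> C)
    (a : 'M[C]_d) : 'M[C]_d :=
  invmx (spectralmx a) *m diag_mx (map_mx f (spectral_diag a))
    *m spectralmx a.

Section positive_operators.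
Context {C : numClosedFieldType} {d : nat}.
Implicit Types (a b q p X Y H : 'M[C]_d) (v w : 'cV[C]_d).

(** Over C = R[i] this is [psd], by conversion. *)
Definition psdmx a := forall v, 0 <= qform a v.

Lemma psd_adj a : psdmx a -> a^t* = a.
Proof.
move=> a0; apply/eqP; rewrite -subr_eq0; apply/eqP/qform_eq0 => v.
by rewrite qformB qform_adj conj_Creal ?subrr//; apply/ger0_real/a0.
Qed.

Lemma psdD a b : psdmx a -> psdmx b -> psdmx (a + b).
Proof. by move=> a0 b0 v; rewrite qformD addr_ge0. Qed.

Lemma psdZ (c : C) a : 0 <= c -> psdmx a -> psdmx (c *: a).
Proof.
move=> c0 a0 v; rewrite /qform /sform -scalemxAr -scalemxAl mxE.
by rewrite mulr_ge0// a0.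
Qed.

Lemma psd_congr X a : psdmx a -> psdmx (X^t* *m a *m X).
Proof. by move=> a0 v; rewrite qform_congr. Qed.

Lemma psd_congr_herm X a : X^t* = X -> psdmx a -> psdmx (X *m a *m X).
Proof. by move=> {1}<-; exact: psd_congr. Qed.

Lemma dot_ge0 v : 0 <= (v^t* *m v) 0 0.
Proof.
rewrite mxE sumr_ge0// => i _; rewrite !mxE mulrC; exact: mul_conjC_ge0.
Qed.

Lemma dot_eq0 v : (v^t* *m v) 0 0 = 0 -> v = 0.
Proof.
rewrite mxE => /eqP; rewrite psumr_eq0 => [/allP v0|i _]; last first.
  by rewrite !mxE mulrC mul_conjC_ge0.
apply/matrixP => i j; rewrite ord1 mxE.
have := v0 i (mem_index_enum i).
by rewrite !mxE mulrC mul_conjC_eq0 => /eqP.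
Qed.

Lemma psd1 : psdmx (1%:M : 'M[C]_d).
Proof. by move=> v; rewrite /qform /sform mulmx1 dot_ge0. Qed.

Lemma psd_scalar (c : C) : 0 <= c -> psdmx (c%:M : 'M[C]_d).
Proof. by move=> c0; rewrite -scalemx1; apply/psdZ/psd1. Qed.

(** The columns of X have the diagonal entries of X^* X as squared norms. *)
Lemma gram_eq0 X : X^t* *m X = 0 -> X = 0.
Proof.
move=> X0; apply/matrixP => i j; rewrite mxE.
have /dot_eq0 /matrixP/(_ i 0) : ((col j X)^t* *m col j X) 0 0 = 0.
  rewrite colE adjmxM !mulmxA -(mulmxA _ (X^t*)) X0 mulmx0 mul0mx.
  by rewrite mxE.
by rewrite !mxE.
Qed.

Lemma unitary_adjV (U : 'M[C]_d) : U \is unitarymx -> U^t* *m U = 1%:M.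
Proof. by move=> Uu; rewrite -{1}invmx_unitary// mulVmx ?unitarymx_unit. Qed.

(** f(a) does not depend on the diagonalisation: the change of basis W between
    two eigenbases has a nonzero entry only where the two eigenvalues agree, so
    W also intertwines the images of the eigenvalues under f. *)
Lemma sfunE f a (U : 'M[C]_d) (l : 'rV[C]_d) : U \is unitarymx ->
  a = U^t* *m diag_mx l *m U ->
  sfun f a = U^t* *m diag_mx (map_mx f l) *m U.
Proof.
move=> Uu aE; have UU := unitary_adjV Uu; have UU' := unitarymxP Uu.
have aN : a \is normalmx.
  apply/orthomx_spectral_subproof; exists (U, l) => //=.
  by rewrite invmx_unitary.
have /orthomx_spectralP aS := aN.
set V := spectralmx a in aS *; set m := spectral_diag a in aS *.
have Vu : V \is unitarymx := spectral_unitarymx a.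
have VV := unitary_adjV Vu; have VV' := unitarymxP Vu.
rewrite invmx_unitary// in aS.
rewrite sfun.unlock invmx_unitary//.
have [W WV] : exists W, W = V *m U^t* by exists (V *m U^t*).
have WE : W *m diag_mx l = diag_mx m *m W.
  have := congr1 (fun M => V *m M *m U^t*) aS; rewrite {1}aE /=.
  rewrite !mulmxA -(mulmxA _ U) UU' mulmx1 -WV => ->.
  by rewrite VV' mul1mx WV !mulmxA.
have WfE : W *m diag_mx (map_mx f l) = diag_mx (map_mx f m) *m W.
  apply/matrixP => i j; have /matrixP/(_ i j) := WE.
  rewrite !mul_mx_diag !mul_diag_mx !mxE mulrC => wE.
  have [->|w0] := eqVneq (W i j) 0; first by rewrite mulr0 mul0r.
  by rewrite mulrC (mulIf w0 wE).
rewrite -/V -/m -mulmxA.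
have -> : diag_mx (map_mx f m) *m V = W *m diag_mx (map_mx f l) *m U.
  by rewrite WfE WV -!mulmxA UU mulmx1.
by rewrite WV !mulmxA VV mul1mx.
Qed.

(** One diagonalisation that computes all functions of a at once.  It reduces
    each identity of the calculus to an identity of scalars. *)
Variant psd_spec a : Prop := PsdSpec (U : 'M[C]_d) (l : 'rV[C]_d) of
  U \is unitarymx & (forall k, 0 <= l 0 k) & a = U^t* *m diag_mx l *m U &
  (forall f, sfun f a = U^t* *m diag_mx (map_mx f l) *m U).

Lemma herm_spectral a : a^t* = a -> exists (U : 'M[C]_d) (l : 'rV[C]_d),
  [/\ U \is unitarymx, forall k, l 0 k \is Num.real &
      a = U^t* *m diag_mx l *m U].
Proof.
move=> aH; have aN : a \is normalmx by apply/normalmxP; rewrite aH.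
have /orthomx_spectralP := aN; rewrite invmx_unitary ?spectral_unitarymx// => aE.
exists (spectralmx a), (spectral_diag a); split=> //.
  exact: spectral_unitarymx.
have /hermitian_spectral_diag_real/mxOverP aR : a \is hermsymmx.
  by apply/is_hermitianmxP; rewrite expr0 scale1r aH.
by move=> k; exact: aR.
Qed.

Lemma qform_diag (U : 'M[C]_d) (l : 'rV[C]_d) k : U \is unitarymx ->
  qform (U^t* *m diag_mx l *m U) (U^t* *m delta_mx k 0) = l 0 k.
Proof.
move=> Uu; rewrite qform_congr mulmxA (unitarymxP Uu) mul1mx.
by rewrite /qform -mx_entryE mxE eqxx mulr1n.
Qed.

Lemma psdP a : psdmx a -> psd_spec a.
Proof.
move=> a0; have [U [l [Uu _ aE]]] := herm_spectral (psd_adj a0).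
apply: (PsdSpec Uu _ aE); last by move=> f; exact: sfunE.
by move=> k; rewrite -(qform_diag l k Uu) -aE; exact: a0.
Qed.

Lemma psd_diag (U : 'M[C]_d) (l : 'rV[C]_d) :
  (forall k, 0 <= l 0 k) -> psdmx (U^t* *m diag_mx l *m U).
Proof.
move=> l0; apply: psd_congr => v; rewrite /qform /sform -mulmxA mul_diag_mx mxE.
apply: sumr_ge0 => i _; rewrite !mxE mulrCA mulr_ge0//.
by rewrite mulrC mul_conjC_ge0.
Qed.

Lemma eq_sfun f g a : psdmx a -> (forall z, 0 <= z -> f z = g z) ->
  sfun f a = sfun g a.
Proof.
move=> /psdP[U l Uu l0 aE sE] fg; rewrite !sE; congr (_ *m diag_mx _ *m _).
by apply/matrixP => i j; rewrite !mxE ord1 fg.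
Qed.

Lemma sfunM f g a : psdmx a ->
  sfun f a *m sfun g a = sfun (fun z => f z * g z) a.
Proof.
move=> /psdP[U l Uu l0 aE sE]; rewrite !sE.
rewrite -!mulmxA (mulmxA U) (unitarymxP Uu) mul1mx; congr (_ *m _).
rewrite !mulmxA; congr (_ *m _).
apply/matrixP => i j; rewrite mul_mx_diag !mxE.
by case: eqVneq => [->|_]; rewrite ?mulr1n // mul0r.
Qed.

Lemma sfunD f g a : psdmx a ->
  sfun f a + sfun g a = sfun (fun z => f z + g z) a.
Proof.
move=> /psdP[U l Uu l0 aE sE]; rewrite !sE -mulmxDl -mulmxDr.
congr (_ *m _ *m _).
by apply/matrixP => i j; rewrite !mxE mulrnDl.
Qed.

Lemma sfunZ (c : C) f a : psdmx a ->
  c *: sfun f a = sfun (fun z => c * f z) a.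
Proof.
move=> /psdP[U l Uu l0 aE sE]; rewrite !sE scalemxAl scalemxAr.
congr (_ *m _ *m _).
by apply/matrixP => i j; rewrite !mxE mulrnAr.
Qed.

Lemma sfun_cst (c : C) a : psdmx a -> sfun (fun=> c) a = c%:M.
Proof.
move=> /psdP[U l Uu l0 aE sE]; rewrite sE.
have -> : diag_mx (map_mx (fun=> c) l) = c%:M.
  by apply/matrixP => i j; rewrite !mxE.
by rewrite mul_mx_scalar -scalemxAl unitary_adjV// scalemx1.
Qed.

Lemma sfun_id a : psdmx a -> sfun id a = a.
Proof.
by move=> /psdP[U l Uu l0 {3}-> ->]; congr (_ *m diag_mx _ *m _);
  apply/matrixP => i j; rewrite !mxE.
Qed.

Lemma sfun_psd f a : psdmx a -> (forall z, 0 <= z -> 0 <= f z) ->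
  psdmx (sfun f a).
Proof.
move=> /psdP[U l Uu l0 aE ->] f0; apply: psd_diag => k.
by rewrite mxE f0.
Qed.

Lemma sfun_comp f g a : psdmx a ->
  sfun f (sfun g a) = sfun (f \o g) a.
Proof.
move=> /psdP[U l Uu l0 aE sE]; rewrite !sE (sfunE _ Uu erefl).
by rewrite -map_mx_comp.
Qed.
End positive_operators.

(** * Square roots and generalised inverses *)

Section square_roots.
Context {C : numClosedFieldType} {d : nat}.
Implicit Types (a b q p X Y J : 'M[C]_d).

Definition sqrtmx a := sfun sqrtC a.

Definition pinv a := sfun (fun z => z^-1) a.

Lemma sqrtmx_psd a : psdmx a -> psdmx (sqrtmx a).
Proof. by move=> a0; apply: sfun_psd => // z; rewrite sqrtC_ge0. Qed.

Lemma sqrtmxK a : psdmx a -> sqrtmx a *m sqrtmx a = a.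
Proof.
move=> a0; rewrite /sqrtmx sfunM// -[RHS]sfun_id//.
by apply: eq_sfun => // z _; rewrite -expr2 sqrtCK.
Qed.

Lemma sqrtmx_sqr a : psdmx a -> sqrtmx (a *m a) = a.
Proof.
move=> a0; rewrite -{1 2}(sfun_id a0) sfunM//.
rewrite /sqrtmx sfun_comp// -[RHS]sfun_id//.
by apply: eq_sfun => // z z0 /=; rewrite -expr2 sqrCK.
Qed.

Lemma pinv_psd a : psdmx a -> psdmx (pinv a).
Proof. by move=> a0; apply: sfun_psd => // z; rewrite invr_ge0. Qed.

Lemma sqrtmx_adj a : psdmx a -> (sqrtmx a)^t* = sqrtmx a.
Proof. by move=> /sqrtmx_psd/psd_adj. Qed.

Lemma pinv_adj a : psdmx a -> (pinv a)^t* = pinv a.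
Proof. by move=> /pinv_psd/psd_adj. Qed.

Lemma pinvK a : psdmx a -> pinv (pinv a) = a.
Proof.
move=> a0; rewrite /pinv sfun_comp// -[RHS]sfun_id//.
by apply: eq_sfun => // z z0 /=; rewrite invrK.
Qed.

Lemma sqrtmx_pinv a : psdmx a -> sqrtmx (pinv a) = pinv (sqrtmx a).
Proof.
move=> a0; rewrite /pinv /sqrtmx !sfun_comp//.
apply: eq_sfun => // z z0 /=.
by rewrite rootCV.
Qed.

Lemma pinv_comm a : psdmx a -> a *m pinv a = pinv a *m a.
Proof.
move=> a0; rewrite -{1 4}(sfun_id a0) /pinv !sfunM//.
by apply: eq_sfun => // z _; rewrite mulrC.
Qed.

Lemma pinv_mulK a : psdmx a -> a *m pinv a *m a = a.
Proof.
move=> a0; rewrite -{1 3 4}(sfun_id a0) /pinv !sfunM//.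
apply: eq_sfun => // z _ /=.
by have [->|z0] := eqVneq z 0; rewrite ?mul0r// mulfV// mul1r.
Qed.

Lemma pinv_unit a : psdmx a -> a \in unitmx -> pinv a = invmx a.
Proof.
move=> a0 au; rewrite -[LHS](mulKmx au) -[in RHS](mulmx1 (invmx a)).
congr (_ *m _); have := pinv_mulK a0.
by move=> /(congr1 (mulmx^~ (invmx a))); rewrite mulmxK// mulmxV.
Qed.

Lemma sqrtmx_unit a : psdmx a -> (sqrtmx a \in unitmx) = (a \in unitmx).
Proof. move=> a0; have := unitmx_mul (sqrtmx a) (sqrtmx a).
by rewrite sqrtmxK// andbb. Qed.

Lemma pinv_unitmx a : psdmx a -> (pinv a \in unitmx) = (a \in unitmx).
Proof.
move=> a0; apply/idP/idP => [u|u]; last by rewrite pinv_unit// unitmx_inv.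
by rewrite -(pinvK a0) pinv_unit ?unitmx_inv//; exact: pinv_psd.
Qed.

(** The resolvent (z + e)^-1 is a function of a that inverts a + e. *)
Lemma psd_unitD (e : C) a : 0 < e -> psdmx a -> a + e%:M \in unitmx.
Proof.
move=> e0 a0.
suff : (a + e%:M) *m sfun (fun z => (z + e)^-1) a = 1%:M.
  by move=> /mulmx1_unit[].
rewrite -{1}(sfun_id a0) -(sfun_cst e a0) sfunD//.
rewrite sfunM// -(sfun_cst 1 a0).
apply: eq_sfun => // z z0; rewrite mulfV// gt_eqF//.
by rewrite ltr_wpDl.
Qed.

(** Loewner's theorem for the square root.  Let v be a unit eigenvector of
    D = Y - X with eigenvalue l.  Since Y^2 - X^2 = D X + Y D, the value of this
    form at v is l <v, (X + Y) v>.  If l were negative, both <v, X v> and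
    <v, Y v> would vanish, and so would l = <v, D v>. *)
Lemma sqr_mono X Y : psdmx X -> psdmx Y -> psdmx (Y *m Y - X *m X) -> psdmx (Y - X).
Proof.
move=> X0 Y0 XY.
have DH : (Y - X)^t* = Y - X by rewrite adjmxB !psd_adj.
have [U [l [Uu lR DE]]] := herm_spectral DH.
rewrite DE; apply: psd_diag => k.
have [v vE] : exists v : 'cV[C]_d, v = U^t* *m delta_mx k 0 by eexists.
have Dv : (Y - X) *m v = l 0 k *: v.
  rewrite DE vE !mulmxA -(mulmxA _ U) (unitarymxP Uu) mulmx1 -mulmxA.
  rewrite scalemxAr; congr (_ *m _).
  apply/matrixP => i j; rewrite mul_diag_mx !mxE.
  by case: eqVneq => [->//|_]; rewrite !mulr0.
have vD : v^t* *m (Y - X) = l 0 k *: v^t*.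
  by rewrite -{1}DH -adjmxM Dv adjmxZ conj_Creal.
have qE : qform (Y *m Y - X *m X) v = l 0 k * (qform Y v + qform X v).
  have -> : Y *m Y - X *m X = (Y - X) *m X + Y *m (Y - X).
    by rewrite mulmxBl mulmxBr [RHS]addrC addrA subrK.
  rewrite qformD /qform /sform !mulmxA vD -[_ *m Y *m _ *m v]mulmxA Dv.
  by rewrite -!scalemxAl -scalemxAr !mxE -mulrDr addrC.
rewrite real_leNgt ?real0//; apply/negP => l0.
have := XY v; rewrite qE nmulr_rge0// => YX.
have Y0v := Y0 v; have X0v := X0 v.
have Yv : qform Y v = 0.
  by apply/eqP; rewrite eq_le Y0v (le_trans _ YX)// lerDl.
have Xv : qform X v = 0.
  by apply/eqP; rewrite eq_le X0v (le_trans _ YX)// lerDr.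
have := qform_diag l k Uu; rewrite -DE qformB -vE Yv Xv subrr => lk.
by move: l0; rewrite -lk ltxx.
Qed.

Lemma sqrtmx_mono a b : psdmx a -> psdmx b -> psdmx (b - a) ->
  psdmx (sqrtmx b - sqrtmx a).
Proof.
move=> a0 b0 ab; apply: sqr_mono; rewrite ?sqrtmxK//; exact: sqrtmx_psd.
Qed.

(** X^* a X is the Gram matrix of a^(1/2) X. *)
Lemma congr_eq0 a X : psdmx a -> X^t* *m a *m X = 0 -> sqrtmx a *m X = 0.
Proof.
move=> a0 aX; apply: gram_eq0; rewrite adjmxM sqrtmx_adj//.
by rewrite mulmxA -(mulmxA (X^t*)) sqrtmxK.
Qed.

End square_roots.

(** * The geometric mean of invertible operators *)

(** The geometric mean by its closed formula, meaningful for invertible a;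
    locked for the same reason as [sfun]. *)
HB.lock Definition gmean (C : numClosedFieldType) (d : nat)
    (a b : 'M[C]_d) : 'M[C]_d :=
  let s := sqrtmx a in let t := pinv s in s *m sqrtmx (t *m b *m t) *m s.

Section geometric_mean.
Context {C : numClosedFieldType} {d : nat}.
Implicit Types (a b q p X Y J : 'M[C]_d).

Lemma gmean_psd a b : psdmx a -> psdmx b -> psdmx (gmean a b).
Proof.
move=> a0 b0; rewrite gmean.unlock /=.
have s0 := sqrtmx_psd a0.
apply: psd_congr_herm; first exact: psd_adj.
by apply/sqrtmx_psd/psd_congr_herm => //; apply: pinv_adj.
Qed.

Lemma sqrtmx_pinvVK a : psdmx a -> a \in unitmx ->
  (sqrtmx a *m pinv (sqrtmx a) = 1%:M) * (pinv (sqrtmx a) *m sqrtmx a = 1%:M).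
Proof.
move=> a0 au; have s0 := sqrtmx_psd a0.
have su : sqrtmx a \in unitmx by rewrite sqrtmx_unit.
by rewrite pinv_unit// mulmxV// mulVmx.
Qed.

(** The Riccati equation X a^-1 X = b, which together with positivity
    characterises the geometric mean. *)
Lemma gmean_eq a b : psdmx a -> a \in unitmx -> psdmx b ->
  gmean a b *m invmx a *m gmean a b = b.
Proof.
move=> a0 au b0; rewrite gmean.unlock /=.
have [st ts] := sqrtmx_pinvVK a0 au.
have s0 := sqrtmx_psd a0; set s := sqrtmx a in st ts s0 *.
set t := pinv s in st ts *.
have aV : invmx a = t *m t.
  apply: (can_inj (mulKmx au)); rewrite mulmxV// -(sqrtmxK a0) -/s.
  by rewrite mulmxA -(mulmxA s) st mulmx1.
have r0 : psdmx (t *m b *m t) by apply: psd_congr_herm => //; exact: pinv_adj.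
rewrite aV !mulmxA -(mulmxA _ s t) st mulmx1 -(mulmxA _ t s) ts mulmx1.
rewrite -(mulmxA s) sqrtmxK// !mulmxA st mul1mx.
by rewrite -mulmxA ts mulmx1.
Qed.

(** With t = a^(-1/2), the equation says that t X t is a positive square root of
    t b t. *)
Lemma gmean_uniq a b X : psdmx a -> a \in unitmx -> psdmx X ->
  X *m invmx a *m X = b -> X = gmean a b.
Proof.
move=> a0 au X0 XE; rewrite gmean.unlock /=.
have [st ts] := sqrtmx_pinvVK a0 au.
have s0 := sqrtmx_psd a0; set s := sqrtmx a in st ts s0 *.
set t := pinv s in st ts *.
have aV : invmx a = t *m t.
  apply: (can_inj (mulKmx au)); rewrite mulmxV// -(sqrtmxK a0) -/s.
  by rewrite mulmxA -(mulmxA s) st mulmx1.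
have r0 : psdmx (t *m X *m t) by apply: psd_congr_herm => //; exact: pinv_adj.
have -> : t *m b *m t = (t *m X *m t) *m (t *m X *m t).
  by rewrite -XE aV !mulmxA.
by rewrite sqrtmx_sqr// !mulmxA st mul1mx -mulmxA ts mulmx1.
Qed.

(** A symmetry J that commutes with a and b maps solutions of the Riccati
    equation to solutions, hence fixes the geometric mean. *)
Lemma gmean_comm a b J : psdmx a -> a \in unitmx -> psdmx b ->
  J^t* = J -> J *m J = 1%:M -> J *m a = a *m J -> J *m b = b *m J ->
  J *m gmean a b = gmean a b *m J.
Proof.
move=> a0 au b0 JH JJ Ja Jb.
have JaV : J *m invmx a = invmx a *m J.
  apply: (can_inj (mulKmx au)); rewrite mulmxA -Ja mulmxK//.
  by rewrite mulKVmx.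
have XE := gmean_eq a0 au b0; have X0 := gmean_psd a0 b0.
have JXJ : J *m gmean a b *m J = gmean a b.
  apply: gmean_uniq => //; first exact: psd_congr_herm.
  move: (gmean a b) XE {X0} => X XE.
  rewrite !mulmxA -(mulmxA _ J (invmx a)) JaV !mulmxA -(mulmxA _ J J) JJ mulmx1.
  by rewrite -(mulmxA J X) -(mulmxA J) XE Jb -mulmxA JJ mulmx1.
by rewrite -{2}JXJ -!mulmxA JJ mulmx1.
Qed.

(** Inverting X a^-1 X = b gives X b^-1 X = a. *)
Lemma gmeanC a b : psdmx a -> a \in unitmx -> psdmx b -> b \in unitmx ->
  gmean a b = gmean b a.
Proof.
move=> a0 au b0 bu; apply: gmean_uniq => //.
  exact: gmean_psd.
move: (gmean a b) (gmean_eq a0 au b0) => X XE.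
have Xu : X \in unitmx.
  by move: bu; rewrite -XE !unitmx_mul => /andP[_].
apply: (can_inj (mulmxK (_ : invmx a \in unitmx))); first by rewrite unitmx_inv.
apply: (can_inj (mulmxK Xu)).
by rewrite mulmxV// mul1mx -!mulmxA (mulmxA X (invmx a))
  XE mulVmx// mulmx1.
Qed.

(** Congruence by a^(1/2) reduces this to monotonicity of the square root. *)
Lemma gmean_monor a b b' : psdmx a -> psdmx b -> psdmx b' -> psdmx (b' - b) ->
  psdmx (gmean a b' - gmean a b).
Proof.
move=> a0 b0 b'0 bb'; rewrite gmean.unlock /=.
have s0 := sqrtmx_psd a0; set s := sqrtmx a in s0 *.
have tH := pinv_adj s0; set t := pinv s in tH *.
rewrite -mulmxBl -mulmxBr; apply: psd_congr_herm; first exact: psd_adj.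
apply: sqrtmx_mono; rewrite -?mulmxBl -?mulmxBr; exact: psd_congr_herm.
Qed.

(** Monotonicity in the second argument gives monotonicity in both, since the
    mean is symmetric. *)
Lemma gmean_mono a b a' b' : psdmx a -> a \in unitmx -> psdmx a' ->
  a' \in unitmx -> psdmx b -> psdmx b' -> b' \in unitmx ->
  psdmx (a' - a) -> psdmx (b' - b) ->
  psdmx (gmean a' b' - gmean a b).
Proof.
move=> a0 au a'0 a'u b0 b'0 b'u aa' bb'.
rewrite -(subrK (gmean a b') (gmean a' b')) -addrA.
apply: psdD; last exact: gmean_monor.
by rewrite (gmeanC a'0)// (gmeanC a0)//; exact: gmean_monor.
Qed.

End geometric_mean.

(** * Limits of matrices *)

Section matrix_limits.
Context {C : numClosedFieldType} {I : Type} (F : set_system I).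
Context {FF : ProperFilter F}.

Definition mxcvg {m n} (f : I -> 'M[C]_(m, n)) (L : 'M[C]_(m, n)) :=
  forall i j, (f x i j : C^o) @[x --> F] --> (L i j : C^o).

Lemma cvg_sumo (J : Type) (r : seq J) (f : J -> I -> C^o) (l : J -> C^o) :
  (forall j, f j @ F --> l j) ->
  (\sum_(j <- r) f j x : C^o) @[x --> F] --> (\sum_(j <- r) l j : C^o).
Proof.
move=> fl; elim: r => [|j r IH].
  rewrite big_nil; under eq_fun do rewrite big_nil; exact: cvg_cst.
rewrite big_cons; under eq_fun do rewrite big_cons.
by apply: cvgD.
Qed.

Lemma mxcvg_cst m n (A : 'M[C]_(m, n)) : mxcvg (fun=> A) A.
Proof. by move=> i j; exact: cvg_cst. Qed.

Lemma mxcvgD m n (f g : I -> 'M[C]_(m, n)) A B :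
  mxcvg f A -> mxcvg g B -> mxcvg (fun x => f x + g x) (A + B).
Proof.
move=> fA gB i j; rewrite mxE; under eq_fun do rewrite mxE.
by apply: cvgD.
Qed.

Lemma mxcvgM m n p (f : I -> 'M[C]_(m, n)) (g : I -> 'M[C]_(n, p)) A B :
  mxcvg f A -> mxcvg g B -> mxcvg (fun x => f x *m g x) (A *m B).
Proof.
move=> fA gB i j; rewrite mxE; under eq_fun do rewrite mxE.
apply: cvg_sumo => k; exact: (@cvgM C _ F FF).
Qed.

Lemma mxcvg_unique m n (f : I -> 'M[C]_(m, n)) A B :
  mxcvg f A -> mxcvg f B -> A = B.
Proof.
move=> fA fB; apply/matrixP => i j.
exact: (cvg_unique (@norm_hausdorff C C^o) (fA i j) (fB i j)).
Qed.

Lemma mxcvg_near m n (f g : I -> 'M[C]_(m, n)) A :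
  (\forall x \near F, f x = g x) -> mxcvg f A -> mxcvg g A.
Proof.
move=> fg fA i j; apply: cvg_trans (fA i j).
by apply: near_eq_cvg; apply: filterS fg => x ->.
Qed.

Lemma cvg_ge0 (f : I -> C^o) (l : C^o) :
  (\forall x \near F, 0 <= f x) -> f @ F --> l -> 0 <= l.
Proof.
move=> f0 fl; have nl : (`|f x| : C^o) @[x --> F] --> (`|l| : C^o).
  exact: (@cvg_norm C C^o I F _ f l fl).
have -> : l = `|l|; last by rewrite normr_ge0.
apply: (cvg_unique (@norm_hausdorff C C^o) fl).
apply: cvg_trans nl; apply: near_eq_cvg.
by apply: filterS f0 => x x0; rewrite ger0_norm.
Qed.

Lemma mxcvg_psd n (f : I -> 'M[C]_n) A :
  (\forall x \near F, psdmx (f x)) -> mxcvg f A -> psdmx A.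
Proof.
move=> f0 fA v.
have fv := mxcvgM (mxcvgM (@mxcvg_cst _ _ (v^t*)) fA) (@mxcvg_cst _ _ v).
apply: cvg_ge0 (fv 0 0).
by apply: filterS f0 => x; exact.
Qed.

(** Only the eigenvalues move, so pointwise convergence of the scalar functions
    suffices. *)
Lemma mxcvg_sfun n (f : I -> C -> C) (g : C -> C) (a : 'M[C]_n) :
  psdmx a ->
  (forall z, 0 <= z -> (f x z : C^o) @[x --> F] --> (g z : C^o)) ->
  mxcvg (fun x => sfun (f x) a) (sfun g a).
Proof.
move=> /psdP[U l Uu l0 aE sE] fg; rewrite sE; under eq_fun do rewrite sE.
apply: mxcvgM; last exact: mxcvg_cst.
apply: mxcvgM; first exact: mxcvg_cst.
move=> i j; rewrite !mxE; under eq_fun do rewrite !mxE.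
by case: (i == j); rewrite ?mulr1n ?mulr0n; [exact: fg|exact: cvg_cst].
Qed.

(** A regularisation of z^-1 with the right value 0 at z = 0. *)
Lemma cvg_reg_inv (e : I -> C^o) (z : C) : e @ F --> (0 : C^o) ->
  (z * (z * z + e x)^-1 : C^o) @[x --> F] --> (z^-1 : C^o).
Proof.
move=> e0; have [->|zn0] := eqVneq z 0.
  by under eq_fun do rewrite mul0r; rewrite invr0; exact: cvg_cst.
have zzV : ((z * z + e x)^-1 : C^o) @[x --> F] --> ((z * z)^-1 : C^o).
  apply: (@cvgV C _ F _ (fun x => z * z + e x)); first by rewrite mulf_neq0.
  have := @cvgD C C^o _ F _ (fun=> z * z) e _ _ (@cvg_cst _ _ _ _ _) e0.
  by rewrite addr0; apply.
have -> : z^-1 = z * (z * z)^-1 by rewrite invfM mulrA mulfV// mul1r.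
by apply: (@cvgM C _ F) => //; exact: cvg_cst.
Qed.

(** Each entry is a combination of four values of the quadratic form. *)
Lemma mxcvg_qform n (f : I -> 'M[C]_n) (l : 'cV[C]_n -> C) :
  (forall v, (qform (f x) v : C^o) @[x --> F] --> (l v : C^o)) ->
  exists L, mxcvg f L.
Proof.
move=> fl; pose e i : 'cV[C]_n := delta_mx i 0.
exists (\matrix_(i, j) (4^-1 * (l (e i + e j) - l (e i + -1 *: e j)
  - 'i * l (e i + 'i *: e j) + 'i * l (e i + - 'i *: e j)))).
move=> i j; rewrite mxE.
have fE x : f x i j = 4^-1 * (qform (f x) (e i + e j)
    - qform (f x) (e i + -1 *: e j)
    - 'i * qform (f x) (e i + 'i *: e j)
    + 'i * qform (f x) (e i + - 'i *: e j)).
  by rewrite -polarization -[sform _ _ _ *+ 4]mulr_natl mulKf ?pnatr_eq0 -?mx_entryE.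
under eq_fun do rewrite fE.
have cM (k : C) v : (k * qform (f x) v : C^o) @[x --> F] --> (k * l v : C^o).
  by apply: (@cvgM C _ F) => //; exact: cvg_cst.
apply: (@cvgM C _ F); first exact: cvg_cst.
apply: (@cvgD C C^o) => //; apply: (@cvgB C C^o) => //.
exact: (@cvgB C C^o).
Qed.

End matrix_limits.
Arguments mxcvg_cst {C I} F {FF m n} A.

(** * The geometric mean of singular operators *)

Section singular_geometric_mean.
Context {C : numClosedFieldType} {d : nat}.
Implicit Types (a q L : 'M[C]_d).

(** The orthogonal projection onto the range of a. *)
Definition rangep a : 'M[C]_d := sfun (fun z => (z != 0)%:R) a.

Lemma rangepE a : psdmx a -> sqrtmx a *m pinv (sqrtmx a) = rangep a.
Proof.
move=> a0; rewrite /pinv {2}/sqrtmx sfun_comp// sfunM//.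
apply: eq_sfun => // z _ /=; have [->|z0] := eqVneq z 0.
  by rewrite sqrtC0 mul0r.
by rewrite mulfV// sqrtC_eq0.
Qed.

Lemma rangepEV a : psdmx a -> pinv (sqrtmx a) *m sqrtmx a = rangep a.
Proof. by move=> a0; rewrite -pinv_comm ?rangepE//; exact: sqrtmx_psd. Qed.

Lemma mx_double_inj (A B : 'M[C]_d) : A + A = B + B -> A = B.
Proof.
move=> AB; apply/matrixP => i j; have /matrixP/(_ i j) := AB.
rewrite mxE [in RHS]mxE -2!mulr2n => /eqP.
by rewrite eqrMn2r //= => /eqP.
Qed.

(** The mean of the generalised inverse of a with some q that lives on the range
    of a.  Put X = (a^-1 + e) # (q + e) and P = [rangep a].  The symmetry 2P - 1
    commutes with both arguments, so P commutes with X.  With R = (a^-1 + e)^-1,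
    the Riccati equation X R X = q + e therefore splits: on the range it tends to
    L a L = q, because P R tends to a; on the complement Q = 1 - P it reads
    X Q X = e^2 Q, so L vanishes there.  Hence a^(1/2) L a^(1/2) is the positive
    square root of a^(1/2) q a^(1/2). *)
Lemma gmean_sing (I : Type) (F : set_system I) (FF : ProperFilter F)
    (e : I -> C) a q L :
  psdmx a -> psdmx q -> rangep a *m q *m rangep a = q ->
  (forall x, 0 < e x) -> (e x : C^o) @[x --> F] --> (0 : C^o) ->
  mxcvg F (fun x => gmean (pinv a + (e x)%:M) (q + (e x)%:M)) L ->
  L = pinv (sqrtmx a) *m sqrtmx (sqrtmx a *m q *m sqrtmx a)
    *m pinv (sqrtmx a).
Proof.
move=> a0 q0 PqP e0 ecvg gL.
have p0 := pinv_psd a0.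
have PP : rangep a *m rangep a = rangep a.
  rewrite sfunM//; apply: eq_sfun => // z _.
  by case: (z != 0); rewrite ?mulr1 ?mulr0.
have P0 : psdmx (rangep a) by apply: sfun_psd => // z _; exact: ler0n.
set P := rangep a in PqP PP P0 *.
have Pq : P *m q = q by rewrite -PqP !mulmxA PP.
have qP : q *m P = q by rewrite -PqP -!mulmxA PP.
pose g x := gmean (pinv a + (e x)%:M) (q + (e x)%:M).
have e_psd x : psdmx ((e x)%:M : 'M[C]_d) by apply/psd_scalar/ltW.
have pe0 x : psdmx (pinv a + (e x)%:M) by exact: psdD.
have qe0 x : psdmx (q + (e x)%:M) by exact: psdD.
have peu x : pinv a + (e x)%:M \in unitmx by exact: psd_unitD.
have g0 x : psdmx (g x) by exact: gmean_psd.
pose R x := sfun (fun z => (z^-1 + e x)^-1) a.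
have RE x : invmx (pinv a + (e x)%:M) = R x.
  apply: (can_inj (mulKmx (peu x))); rewrite mulmxV//.
  rewrite /pinv -(sfun_cst (e x) a0) sfunD// /R sfunM// -(sfun_cst 1 a0).
  apply: eq_sfun => // z z0; rewrite mulfV// gt_eqF//.
  by rewrite ltr_wpDl// invr_ge0.
have gE x : g x *m R x *m g x = q + (e x)%:M.
  by rewrite -RE; exact: gmean_eq.
have gP x : P *m g x = g x *m P.
  pose J : 'M[C]_d := P + P - 1%:M.
  have JJ : J *m J = 1%:M.
    have JP : J *m P = P by rewrite mulmxBl mulmxDl PP mul1mx addrK.
    by rewrite {2}/J mulmxBr mulmxDr JP mulmx1 /J opprB addrC subrK.
  have JH : J^t* = J.
    by rewrite adjmxB adjmxD (psd_adj P0) adjmx_scalar conjC1.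
  have JP' (b : 'M[C]_d) : P *m b = b *m P -> J *m b = b *m J.
    by move=> Pb; rewrite mulmxBr mulmxDr mulmxBl mulmxDl Pb mul1mx mulmx1.
  have Jg : J *m g x = g x *m J.
    apply: gmean_comm => //; apply: JP'.
      rewrite mulmxDl mulmxDr mul_mx_scalar mul_scalar_mx; congr (_ + _).
      by rewrite !sfunM//; apply: eq_sfun => // z _; rewrite mulrC.
    by rewrite mulmxDl mulmxDr Pq qP mul_mx_scalar mul_scalar_mx.
  move: Jg; rewrite mulmxBl mulmxBr mulmxDl mulmxDr mul1mx mulmx1.
  by move=> /(addIr (- g x)); exact: mx_double_inj.
have eM : mxcvg F (fun x => (e x)%:M : 'M[C]_d) 0.
  move=> i j; rewrite mxE; under eq_fun do rewrite mxE.
  by case: (i == j); rewrite ?mulr1n ?mulr0n//; exact: cvg_cst.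
have cvgPR : mxcvg F (fun x => P *m R x) a.
  rewrite -[a in mxcvg _ _ a]sfun_id//.
  under eq_fun do rewrite sfunM//.
  apply: mxcvg_sfun => // z z0.
  have [->|zn0] := eqVneq z 0.
    by under eq_fun do rewrite mul0r; exact: cvg_cst.
  under eq_fun do rewrite mul1r.
  have := @cvgV C _ F _ (fun x => z^-1 + e x) z^-1.
  rewrite invrK; apply; first by rewrite invr_eq0.
  have := @cvgD C C^o I F _ (fun=> z^-1) e z^-1 0 (@cvg_cst _ _ _ _ _) ecvg.
  by rewrite addr0; apply.
have LaL : L *m a *m L = q.
  apply: (@mxcvg_unique _ _ F FF _ _ _ _ _ (mxcvgM (mxcvgM gL cvgPR) gL)).
  rewrite -[q in mxcvg _ _ q]Pq -[q in mxcvg _ _ (_ *m q)]addr0.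
  apply: mxcvg_near (mxcvgM (mxcvg_cst _ P) (mxcvgD (mxcvg_cst _ q) eM)).
  apply: nearW => x; rewrite -/(g x) -gE !mulmxA.
  by rewrite -(gP x).
have L0 : psdmx L by apply: mxcvg_psd gL; exact: nearW.
have LH := psd_adj L0.
pose Q : 'M[C]_d := 1%:M - P.
have QR x : Q *m R x = (e x)^-1 *: Q.
  have -> : Q = sfun (fun z => 1 - (z != 0)%:R) a.
    rewrite /Q /P /rangep -(sfun_cst 1 a0) -scaleN1r sfunZ// sfunD//.
    by apply: eq_sfun => // z _; rewrite mulN1r.
  rewrite sfunM// sfunZ//; apply: eq_sfun => // z z0.
  have [->|_] := eqVneq z 0; first by rewrite invr0 add0r mulrC.
  by rewrite subrr mul0r mulr0.
have Qq : Q *m q = 0 by rewrite mulmxBl Pq mul1mx subrr.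
have gQ x : Q *m g x = g x *m Q by rewrite mulmxBl mulmxBr gP mul1mx mulmx1.
have gQg x : g x *m Q *m g x = (e x * e x) *: Q.
  have ex0 : e x != 0 by rewrite gt_eqF.
  have : (e x)^-1 *: (g x *m Q *m g x) = e x *: Q.
    rewrite scalemxAl scalemxAr -QR mulmxA -gQ -!mulmxA (mulmxA (g x)) gE.
    by rewrite mulmxDr Qq add0r mul_mx_scalar.
  by move=> /(congr1 ( *:%R (e x))); rewrite !scalerA mulfV// scale1r.
have LQL : L *m Q *m L = 0.
  have h : mxcvg F (fun x => g x *m Q *m g x) (L *m Q *m L).
    by apply: mxcvgM => //; apply: mxcvgM => //; exact: mxcvg_cst.
  have h0 : mxcvg F (fun x => ((e x)%:M *m (e x)%:M) *m Q)
      (0 *m (0 : 'M[C]_d) *m Q).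
    by apply: mxcvgM; [exact: mxcvgM|exact: mxcvg_cst].
  rewrite !mul0mx in h0; apply: (mxcvg_unique h); apply: mxcvg_near h0.
  apply: nearW => x.
  by rewrite gQg mul_scalar_mx scale_scalar_mx mul_scalar_mx.
have PQ : P *m Q = 0 by rewrite mulmxBr mulmx1 PP subrr.
have QQ : Q *m Q = Q by rewrite {1}/Q mulmxBl mul1mx PQ subr0.
have QH : Q^t* = Q by rewrite adjmxB (psd_adj P0) adjmx_scalar conjC1.
have QL : Q *m L = 0.
  apply: gram_eq0; rewrite adjmxM LH QH mulmxA -(mulmxA L) QQ; exact: LQL.
have PL : P *m L = L.
  by move/eqP: QL; rewrite mulmxBl mul1mx subr_eq0 => /eqP.
have LP : L *m P = L.
  by rewrite -{1}LH -(psd_adj P0) -adjmxM PL.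
have sH := sqrtmx_adj a0.
have -> : sqrtmx a *m q *m sqrtmx a =
    (sqrtmx a *m L *m sqrtmx a) *m (sqrtmx a *m L *m sqrtmx a).
  rewrite -LaL -{2}(sqrtmxK a0) !mulmxA //.
rewrite sqrtmx_sqr; last exact: psd_congr_herm.
by rewrite !mulmxA rangepEV// -!mulmxA rangepE// LP PL.
Qed.

Lemma gmean_unit a q : psdmx a -> a \in unitmx ->
  gmean (pinv a) q = pinv (sqrtmx a) *m sqrtmx (sqrtmx a *m q *m sqrtmx a)
    *m pinv (sqrtmx a).
Proof.
move=> a0 au; rewrite gmean.unlock /= sqrtmx_pinv// pinvK//; exact: sqrtmx_psd.
Qed.

End singular_geometric_mean.

(** * Existence of the regularised geometric mean *)

Section complex_limits.
Context {R : realType} {I : Type} (F : set_system I) {FF : ProperFilter F}.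
Local Notation C := R[i].

Lemma normRe_le (z : C) : (`|complex.Re z|)%:C <= `|z|.
Proof. exact: normc_ge_Re. Qed.

Lemma normIm_le (z : C) : (`|complex.Im z|)%:C <= `|z|.
Proof.
have := normc_ge_Re (z * 'i); rewrite ReiNIm normrN => /le_trans; apply.
by rewrite normrM normCi mulr1.
Qed.

Lemma norm_le_ReIm (z : C) :
  `|z| <= (`|complex.Re z| + `|complex.Im z|)%:C.
Proof.
rewrite {1}(complexE z) (le_trans (ler_normD _ _))// normrM complexiE normCi.
by rewrite mul1r !normc_def /= expr0n /= !addr0 !sqrtr_sqr rmorphD.
Qed.

(** The norm of a complex number is squeezed between those of its real and
    imaginary parts and their sum. *)
Lemma cvg_complexP (f : I -> C) (l : C) :
  ((f x : C^o) @[x --> F] --> (l : C^o)) <->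
  (complex.Re (f x) @[x --> F] --> complex.Re l) /\
  (complex.Im (f x) @[x --> F] --> complex.Im l).
Proof.
split=> [/cvgrPdist_lt fl|[/cvgrPdist_lt fRe /cvgrPdist_lt fIm]].
  split; apply/cvgrPdist_lt => e e0.
    have /fl : 0 < e%:C by rewrite ltcR.
    apply: filterS => x; rewrite -ltcR; apply: le_lt_trans.
    by rewrite -raddfB normRe_le.
  have /fl : 0 < e%:C by rewrite ltcR.
  apply: filterS => x; rewrite -ltcR; apply: le_lt_trans.
  by rewrite -raddfB normIm_le.
apply/cvgrPdist_lt => e e0.
have eE : e = (complex.Re e)%:C by rewrite RRe_real// gtr0_real.
have e2 : 0 < complex.Re e / 2 by rewrite divr_gt0// -ltcR -eE.
near=> x; rewrite (le_lt_trans (norm_le_ReIm _))// eE ltcR.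
rewrite [ltRHS]splitr !raddfB /= ltrD//; near: x.
  exact: fRe.
exact: fIm.
Unshelve. all: by end_near. Qed.

End complex_limits.

Section geometric_mean_limit.
Context {R : realType}.
Local Notation C := R[i].

(** In finite dimension the strong operator topology is the topology of
    convergence of entries. *)
Lemma mulmx_cvgP d (I : Type) (F : set_system I) (FF : ProperFilter F)
    (f : I -> 'M[C]_d) L :
  (forall v : 'cV[C]_d, (f x *m v : 'cV[C^o]_d) @[x --> F]
     --> (L *m v : 'cV[C^o]_d)) <-> mxcvg F f L.
Proof.
split=> [fL i j A nA|fL v].
  suff nS : nbhs (L *m delta_mx j 0 : 'cV[C^o]_d) [set w | A (w i 0)].
    have := fL _ _ nS; apply: (@filterS _ F _) => x.
    by rewrite /= -colE mxE.
  have /= LE : (L *m delta_mx j 0 : 'cV[C]_d) i 0 = L i j by rewrite -colE mxE.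
  exists (fun i' _ => if i' == i then A else setT) => /=.
    move=> i' k; case: eqVneq => [->|_]; last exact: filterT.
    by rewrite ord1 LE.
  by move=> w /(_ i 0); rewrite eqxx.
move=> A [P nP PA].
have fv : mxcvg F (fun x => f x *m v) (L *m v).
  by apply: mxcvgM => //; exact: mxcvg_cst.
have nf : F [set x | forall ij : 'I_d * 'I_1, P ij.1 ij.2 ((f x *m v) ij.1 ij.2)].
  apply: (@filter_forall I ('I_d * 'I_1)%type
    (fun ij => [set x | P ij.1 ij.2 ((f x *m v) ij.1 ij.2)]) F) => -[i j] /=.
  exact: (fv i j _ (nP i j)).
apply: (@filterS I F _ _ _ _ nf) => x nx.
by apply: PA => i j; exact: (nx (i, j)).
Qed.

Variable d : nat.
Implicit Types (a b p q : 'M[C]_d).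

(** The quadratic forms are monotone and bounded below by 0, so they converge;
    polarization carries this to the entries. *)
Lemma psd_mono_cvg (g : R -> 'M[C]_d) :
  (forall e, 0 < e -> psdmx (g e)) ->
  (forall e e', 0 < e -> e <= e' -> psdmx (g e' - g e)) ->
  exists L, mxcvg 0^'+ g L.
Proof.
move=> g0 gmono; pose h v e := complex.Re (qform (g e) v).
have gh e v : 0 < e -> qform (g e) v = (h v e)%:C.
  by move=> e0; rewrite /h RRe_real//; exact/ger0_real/g0.
have hcvg v : cvg (h v e @[e --> 0^'+]).
  apply: nondecreasing_at_right_is_cvgr; apply: nearW => x.
    move=> e e'; rewrite !in_itv /= => /andP[e0 _] /andP[e'0 _] ee'.
    have := gmono _ _ e0 ee' v; rewrite qformB (gh _ _ e0) (gh _ _ e'0).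
    by rewrite subr_ge0 lecR.
  exists 0 => y [e /=]; rewrite in_itv /= => /andP[e0 _] <-.
  by rewrite -lecR -gh//; exact: g0.
apply: (@mxcvg_qform _ _ _ _ _ _ (fun v => (lim (h v e @[e --> 0^'+]))%:C)).
move=> v.
have hC : ((h v e)%:C : C^o) @[e --> 0^'+] -->
    ((lim (h v e @[e --> 0^'+]))%:C : C^o).
  by apply/cvg_complexP; split => /=; [exact: hcvg|exact: cvg_cst].
apply: cvg_trans hC; apply: near_eq_cvg; near=> e.
by rewrite gh//; near: e; exact: nbhs_right_gt.
Unshelve. all: by end_near. Qed.

(** Both regularised arguments increase with e, so the mean does. *)
Lemma gmean_reg_cvg a b : psdmx a -> psdmx b -> exists L,
  mxcvg 0^'+ (fun e : R => gmean (a + (e%:C)%:M) (b + (e%:C)%:M)) L.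
Proof.
move=> a0 b0.
have reg0 (c : 'M[C]_d) e : psdmx c -> 0 < e -> psdmx (c + (e%:C)%:M).
  by move=> c0 e0; apply/psdD/psd_scalar => //; rewrite lecR ltW.
have regu (c : 'M[C]_d) (e : R) : psdmx c -> 0 < e -> c + (e%:C)%:M \in unitmx.
  by move=> c0 e0; apply: psd_unitD => //; rewrite ltcR.
have regm (c : 'M[C]_d) (e e' : R) : e <= e' ->
    psdmx (c + (e'%:C)%:M - (c + (e%:C)%:M)).
  move=> ee'; rewrite opprD addrACA subrr add0r -raddfB /=.
  by apply: psd_scalar; rewrite -rmorphB lecR subr_ge0.
apply: psd_mono_cvg => [e e0|e e' e0 ee'].
  exact: gmean_psd (reg0 _ _ _ _) (reg0 _ _ _ _).
have e'0 := lt_le_trans e0 ee'.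
exact: (gmean_mono (reg0 _ _ a0 e0) (regu _ _ a0 e0) (reg0 _ _ a0 e'0)
  (regu _ _ a0 e'0) (reg0 _ _ b0 e0) (reg0 _ _ b0 e'0) (regu _ _ b0 e'0)
  (regm _ _ _ ee') (regm _ _ _ ee')).
Qed.

Lemma sqrtmE a : sqrtm a = sqrtmx a.
Proof. by rewrite /sqrtmx sfun.unlock. Qed.

Lemma ginvE a : ginv a = pinv a.
Proof. by rewrite /pinv sfun.unlock. Qed.

Lemma geomean_invE a b : geomean_inv a b = gmean a b.
Proof. by rewrite gmean.unlock /geomean_inv /= !sqrtmE !ginvE. Qed.

(** The regularised limit always exists, so the second case is a genuine limit
    and never the default value of the choice operator. *)
Variant geomean_spec a b : 'M[C]_d -> Prop :=
| GeomeanUnit of a \in unitmx & b \in unitmx : geomean_spec a b (gmean a b)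
| GeomeanLim L of ~~ ((a \in unitmx) && (b \in unitmx)) &
    mxcvg 0^'+ (fun e : R => gmean (a + (e%:C)%:M) (b + (e%:C)%:M)) L :
    geomean_spec a b L.

Lemma geomeanP a b : psdmx a -> psdmx b -> geomean_spec a b (geomean a b).
Proof.
move=> a0 b0; rewrite /geomean; case: ifPn => [/andP[au bu]|nu].
  by rewrite geomean_invE; constructor.
constructor => //.
have [L gL] := gmean_reg_cvg a0 b0.
have gE : @geomean_inv R d = @gmean C d.
  by apply/funext => x; apply/funext => y; exact: geomean_invE.
rewrite gE; set S := [set m | _]; apply/mulmx_cvgP.
suff : S (xget 0 S) by [].
by apply: xgetPex; exists L; apply/mulmx_cvgP.
Qed.

Lemma geomean_psd a b : psdmx a -> psdmx b -> psdmx (geomean a b).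
Proof.
move=> a0 b0; case: (geomeanP a0 b0) => [_ _|L _].
  exact: (gmean_psd a0 b0).
apply: mxcvg_psd; near=> e.
have e0 : 0 < e by near: e; exact: nbhs_right_gt.
by apply: gmean_psd; apply/psdD/psd_scalar => //; rewrite lecR ltW.
Unshelve. all: by end_near. Qed.

Lemma geomean_formula a q : psdmx a -> psdmx q ->
  rangep a *m q *m rangep a = q ->
  geomean (pinv a) q = pinv (sqrtmx a)
    *m sqrtmx (sqrtmx a *m q *m sqrtmx a) *m pinv (sqrtmx a).
Proof.
move=> a0 q0 PqP; have p0 := pinv_psd a0.
case: (geomeanP p0 q0) => [pu _|L _ gL].
  by apply: gmean_unit => //; rewrite -pinv_unitmx.
(* The regularisation must be positive for all e, while e only tends to 0 from the
   right. *)
pose e' (e : R) : C := if 0 < e then e%:C else 1.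
apply: (@gmean_sing _ _ _ 0^'+ _ e') => //.
- by move=> e; rewrite /e'; case: ifPn => [|_]; rewrite ?ltcR ?ltr01.
- have eC : (e%:C : C^o) @[e --> (0 : R)^'+] --> (0 : C^o).
    apply/cvg_complexP; split => /=; last exact: cvg_cst.
    by apply: cvg_at_right_filter; exact: cvg_id.
  apply: cvg_trans eC; apply: near_eq_cvg.
  by apply: filterS (nbhs_right_gt (0 : R)) => e e0; rewrite /e' e0.
- apply: mxcvg_near gL.
  by apply: filterS (nbhs_right_gt (0 : R)) => e e0; rewrite /e' e0.
Qed.

End geometric_mean_limit.

(** * Measurability of matrix valued functions *)

Section complex_measurability.
Context {R : realType} {disp : measure_display} {T : measurableType disp}.
Local Notation C := R[i].
Implicit Types f g : T -> C.

Lemma cmeasurable_cst (c : C) : cmeasurable (fun _ : T => c).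
Proof. by split; exact: measurable_cst. Qed.

Lemma cmeasurableD f g : cmeasurable f -> cmeasurable g ->
  cmeasurable (fun x => f x + g x).
Proof.
move=> [fr fi] [gr gi]; split; under eq_fun do rewrite raddfD /=;
  exact: measurable_funD.
Qed.

Lemma complex_ReM (z w : C) : complex.Re (z * w) =
  complex.Re z * complex.Re w - complex.Im z * complex.Im w.
Proof. by case: z w => [a b] [c e]. Qed.

Lemma complex_ImM (z w : C) : complex.Im (z * w) =
  complex.Re z * complex.Im w + complex.Im z * complex.Re w.
Proof. by case: z w => [a b] [c e]. Qed.

Lemma cmeasurableM f g : cmeasurable f -> cmeasurable g ->
  cmeasurable (fun x => f x * g x).
Proof.
move=> [fr fi] [gr gi]; split.
  under eq_fun do rewrite complex_ReM.
  by apply: measurable_funB; exact: measurable_funM.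
under eq_fun do rewrite complex_ImM.
by apply: measurable_funD; exact: measurable_funM.
Qed.

Lemma cmeasurable_sum (I : Type) (r : seq I) (P : pred I) (f : I -> T -> C) :
  (forall i, cmeasurable (f i)) -> cmeasurable (fun x => \sum_(i <- r | P i) f i x).
Proof.
move=> fm; elim: r => [|i r IH].
  by under eq_fun do rewrite big_nil; exact: cmeasurable_cst.
under eq_fun do rewrite big_cons; case: (P i) => //.
exact: cmeasurableD.
Qed.

Lemma cmeasurable_prod (I : Type) (r : seq I) (P : pred I) (f : I -> T -> C) :
  (forall i, cmeasurable (f i)) -> cmeasurable (fun x => \prod_(i <- r | P i) f i x).
Proof.
move=> fm; elim: r => [|i r IH].
  by under eq_fun do rewrite big_nil; exact: cmeasurable_cst.
under eq_fun do rewrite big_cons; case: (P i) => //.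
exact: cmeasurableM.
Qed.

Lemma cmeasurable_lim (h : nat -> T -> C) f : (forall n, cmeasurable (h n)) ->
  (forall x, (h n x : C^o) @[n --> \oo] --> (f x : C^o)) -> cmeasurable f.
Proof.
move=> hm hf; split.
  apply: (@measurable_fun_cvg _ T R setT (fun n x => complex.Re (h n x))).
    by move=> n; exact: (hm n).1.
  by move=> x _; have /cvg_complexP[] := hf x.
apply: (@measurable_fun_cvg _ T R setT (fun n x => complex.Im (h n x))).
  by move=> n; exact: (hm n).2.
by move=> x _; have /cvg_complexP[] := hf x.
Qed.

Lemma cmeasurable_if f g (b : T -> bool) : measurable_fun setT b ->
  cmeasurable f -> cmeasurable g ->
  cmeasurable (fun x => if b x then f x else g x).
Proof.
move=> mb [fr fi] [gr gi]; split.
  under eq_fun do rewrite fun_if; exact: measurable_fun_ifT.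
under eq_fun do rewrite fun_if; exact: measurable_fun_ifT.
Qed.

Lemma cmeasurable_eq0 f : cmeasurable f -> measurable_fun setT (fun x => f x == 0).
Proof.
move=> [fr fi]; under eq_fun do rewrite eq_complex /=.
apply: measurable_and; apply: measurable_fun_eqr => //; exact: measurable_cst.
Qed.

(** Since 0^-1 = 0, the inverse of a real h is h times (h^2)^-1, and on
    nonnegative reals the inverse is a real power. *)
Lemma measurable_funV (h : T -> R) : measurable_fun setT h ->
  measurable_fun setT (fun x => (h x)^-1).
Proof.
move=> hm; have -> : (fun x => (h x)^-1) = (fun x => h x * powR (h x ^+ 2) (-1)).
  apply/funext => x; rewrite powR_inv1 ?sqr_ge0//.
  have [->|h0] := eqVneq (h x) 0; first by rewrite invr0 mul0r.
  by rewrite expr2 invfM mulrA divff// mul1r.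
apply: measurable_funM => //.
apply: (@measurableT_comp _ _ _ _ _ _ (@powR R ^~ (-1))).
  exact: measurable_powR.
exact: measurable_funX.
Qed.

Lemma cmeasurableV f : cmeasurable f -> cmeasurable (fun x => (f x)^-1).
Proof.
move=> [fr fi]; have m2 : measurable_fun setT
    (fun x => (complex.Re (f x) ^+ 2 + complex.Im (f x) ^+ 2)^-1).
  by apply: measurable_funV; apply: measurable_funD; exact: measurable_funX.
have VE (z : C) : z^-1 =
    (complex.Re z * (complex.Re z ^+ 2 + complex.Im z ^+ 2)^-1)
    +i* (- (complex.Im z * (complex.Re z ^+ 2 + complex.Im z ^+ 2)^-1)).
  by case: z.
split; under eq_fun do rewrite VE /=; last apply: measurable_funN;
  exact: measurable_funM.
Qed.

Definition mxmeas m n (f : T -> 'M[C]_(m, n)) :=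
  forall i j, cmeasurable (fun x => f x i j).

Lemma mxmeas_cst m n (A : 'M[C]_(m, n)) : mxmeas (fun=> A).
Proof. by move=> i j; exact: cmeasurable_cst. Qed.

Lemma mxmeasD m n (f g : T -> 'M[C]_(m, n)) :
  mxmeas f -> mxmeas g -> mxmeas (fun x => f x + g x).
Proof.
by move=> fm gm i j; under eq_fun do rewrite mxE; exact: cmeasurableD.
Qed.

Lemma mxmeasZ m n (c : T -> C) (f : T -> 'M[C]_(m, n)) :
  cmeasurable c -> mxmeas f -> mxmeas (fun x => c x *: f x).
Proof.
by move=> cm fm i j; under eq_fun do rewrite mxE; exact: cmeasurableM.
Qed.

Lemma mxmeasM m n p (f : T -> 'M[C]_(m, n)) (g : T -> 'M[C]_(n, p)) :
  mxmeas f -> mxmeas g -> mxmeas (fun x => f x *m g x).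
Proof.
move=> fm gm i j; under eq_fun do rewrite mxE.
by apply: cmeasurable_sum => k; exact: cmeasurableM.
Qed.

Lemma cmeasurable_det n (f : T -> 'M[C]_n) : mxmeas f ->
  cmeasurable (fun x => \det (f x)).
Proof.
move=> fm; apply: cmeasurable_sum => s; apply: cmeasurableM.
  exact: cmeasurable_cst.
by apply: cmeasurable_prod => i; exact: fm.
Qed.

(** The entries of the inverse are quotients of determinants. *)
Lemma mxmeas_invmx n (f : T -> 'M[C]_n) : (forall x, f x \in unitmx) ->
  mxmeas f -> mxmeas (fun x => invmx (f x)).
Proof.
move=> fu fm; under [X in mxmeas X]eq_fun do rewrite /invmx fu.
apply: mxmeasZ; first by apply: cmeasurableV; exact: cmeasurable_det.
move=> i j; under eq_fun do rewrite mxE.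
apply: cmeasurableM; first exact: cmeasurable_cst.
apply: cmeasurable_det => k l.
by under eq_fun do rewrite !mxE; exact: fm.
Qed.

Lemma mxmeas_lim m n (h : nat -> T -> 'M[C]_(m, n)) (f : T -> 'M[C]_(m, n)) :
  (forall k, mxmeas (h k)) -> (forall x, mxcvg \oo (h ^~ x) (f x)) -> mxmeas f.
Proof.
move=> hm hf i j; apply: (cmeasurable_lim (h := fun k x => h k x i j)).
  by move=> k; exact: hm.
by move=> x; exact: hf.
Qed.

Lemma mxmeas_if m n (f g : T -> 'M[C]_(m, n)) (b : T -> bool) :
  measurable_fun setT b -> mxmeas f -> mxmeas g ->
  mxmeas (fun x => if b x then f x else g x).
Proof.
move=> mb fm gm i j.
have -> : (fun x => (if b x then f x else g x) i j) =
    (fun x => if b x then f x i j else g x i j).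
  by apply/funext => x; case: (b x).
exact: cmeasurable_if.
Qed.

Lemma measurable_unitmx n (f : T -> 'M[C]_n) : mxmeas f ->
  measurable_fun setT (fun x => f x \in unitmx).
Proof.
move=> fm; under eq_fun do rewrite unitmxE unitfE.
by apply: measurable_neg; apply: cmeasurable_eq0; exact: cmeasurable_det.
Qed.

End complex_measurability.

(** * Measurability of the functional calculus *)

Section heron.
Context {C : numClosedFieldType}.

(** The Babylonian iteration for the square root.  It starts from 1, which makes
    all iterates positive on [0, +oo[, 0 included, so that each of them can be
    evaluated at a positive matrix with sums, products and inverses only. *)
Fixpoint heron k (z : C) : C :=
  if k is k'.+1 then 2^-1 * (heron k' z + z * (heron k' z)^-1) else 1.

Lemma heron_gt0 k z : 0 <= z -> 0 < heron k z.
Proof.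
move=> z0; elim: k => [|k IH] /=; first exact: ltr01.
by rewrite mulr_gt0 ?invr_gt0 ?ltr0n// ltr_wpDr// mulr_ge0// invr_ge0 ltW.
Qed.

(** The usual quadratic error identity of Newton's method; the bound below needs
    only that the error is nonnegative after one step and at least halved by each
    further step. *)
Lemma heron_err k z : 0 <= z ->
  heron k.+1 z - sqrtC z = 2^-1 * (heron k z - sqrtC z) ^+ 2 / heron k z.
Proof.
move=> z0 /=; have := heron_gt0 k z0; move: (heron k z) => y y0.
have yn0 : y != 0 by rewrite gt_eqF.
by move: (sqrtCK z); move: (sqrtC z) => s <-; field.
Qed.

Lemma heron_bound k z : 0 <= z ->
  0 <= heron k.+1 z - sqrtC z <= (heron 1 z - sqrtC z) * 2^-1 ^+ k.
Proof.
move=> z0; have s0 : 0 <= sqrtC z by rewrite sqrtC_ge0.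
have sr : sqrtC z \is Num.real := ger0_real s0.
have ge k' : 0 <= heron k'.+1 z - sqrtC z.
  rewrite heron_err// divr_ge0 ?(ltW (heron_gt0 _ _))//.
  rewrite mulr_ge0 ?invr_ge0 ?ler0n//.
  by rewrite real_exprn_even_ge0// rpredB// gtr0_real// heron_gt0.
rewrite ge andTb; elim: k => [|k IH]; first by rewrite expr0 mulr1.
rewrite exprSr mulrA; apply: le_trans (ler_wpM2r _ IH); last first.
  by rewrite invr_ge0 ler0n.
rewrite heron_err//; have := heron_gt0 k.+1 z0; have := ge k.
move: (heron k.+1 z) => y D0 y0.
rewrite -mulrA mulrC ler_wpM2r ?invr_ge0 ?ler0n// ler_pdivrMr// expr2.
by rewrite ler_wpM2l// lerBlDr lerDl.
Qed.

End heron.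

Section measurable_functional_calculus.
Context {R : realType} {disp : measure_display} {T : measurableType disp}.
Context {d : nat}.
Local Notation C := R[i].
Implicit Types a b : T -> 'M[C]_d.

Lemma heron_cvg (z : C) : 0 <= z ->
  (heron k z : C^o) @[k --> \oo] --> (sqrtC z : C^o).
Proof.
move=> z0; rewrite -cvg_shiftS /=; apply/cvgrPdist_lt => e e0.
have eE : e = (complex.Re e)%:C by rewrite RRe_real// gtr0_real.
pose c := heron 1 z - sqrtC z.
have c0 : 0 <= c by have /andP[] := heron_bound 0 z0.
have cE : c = (complex.Re c)%:C by rewrite RRe_real// ger0_real.
have h : (complex.Re c * 2^-1 ^+ k : R) @[k --> \oo] --> (0 : R).
  apply: (@cvg_geometric R (complex.Re c) 2^-1).
  by rewrite ger0_norm ?invr_ge0// invf_lt1 ?ltr1n.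
have /cvgrPdist_lt /(_ (complex.Re e)) := h.
have -> : 0 < complex.Re e by rewrite -ltcR -eE.
move=> /(_ isT); apply: filterS => k.
have /andP[k0 kle] := heron_bound k z0.
rewrite sub0r normrN => hk; rewrite distrC ger0_norm//.
apply: le_lt_trans kle _; rewrite -/c cE eE.
have -> : (2^-1 : C) = (2^-1)%:C by rewrite rmorphV ?unitfE ?pnatr_eq0//= rmorph_nat.
rewrite -rmorphXn -rmorphM ltcR.
exact: le_lt_trans (ler_norm _) hk.
Qed.

Lemma mxmeas_heron a k : (forall x, psdmx (a x)) -> mxmeas a ->
  mxmeas (fun x => sfun (heron k) (a x)).
Proof.
move=> a0 am; elim: k => [|k IH].
  under [X in mxmeas X]eq_fun do rewrite (sfun_cst 1 (a0 _)).
  exact: mxmeas_cst.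
have VE x : sfun (fun z => (heron k z)^-1) (a x) = invmx (sfun (heron k) (a x))
    /\ sfun (heron k) (a x) \in unitmx.
  have YV : sfun (heron k) (a x) *m sfun (fun z => (heron k z)^-1) (a x) = 1%:M.
    rewrite sfunM// -(sfun_cst 1 (a0 x)); apply: eq_sfun => // z z0.
    by rewrite mulfV// gt_eqF// heron_gt0.
  have [Yu _] := mulmx1_unit YV; split=> //.
  by apply: (can_inj (mulKmx Yu)); rewrite YV mulmxV.
have E x : sfun (heron k.+1) (a x) = 2^-1 *: (sfun (heron k) (a x)
    + a x *m invmx (sfun (heron k) (a x))).
  by rewrite -(VE x).1 -{3}(sfun_id (a0 x)) sfunM// sfunD// sfunZ.
under [X in mxmeas X]eq_fun do rewrite E.
apply: mxmeasZ; first exact: cmeasurable_cst.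
apply: mxmeasD => //; apply: mxmeasM => //.
by apply: mxmeas_invmx => // x; exact: (VE x).2.
Qed.

(** The square root is a pointwise limit of the Babylonian iterates on
    [0, +oo[, and these are rational functions of the entries. *)
Lemma mxmeas_sqrtmx a : (forall x, psdmx (a x)) -> mxmeas a ->
  mxmeas (fun x => sqrtmx (a x)).
Proof.
move=> a0 am.
apply: (@mxmeas_lim _ _ _ _ _ (fun k x => sfun (heron k) (a x))).
  by move=> k; exact: mxmeas_heron.
by move=> x; apply: mxcvg_sfun => // z; exact: heron_cvg.
Qed.

Lemma harmonicC_cvg : ((k.+1%:R^-1 : R)%:C : C^o) @[k --> \oo] --> (0 : C^o).
Proof.
by apply/cvg_complexP; split => /=; [exact: cvg_harmonic|exact: cvg_cst].
Qed.

Lemma harmonicC_gt0 k : 0 < (k.+1%:R^-1 : R)%:C.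
Proof. by rewrite ltcR invr_gt0. Qed.

Lemma mxmeas_reg a k : mxmeas a ->
  mxmeas (fun x => a x + ((k.+1%:R^-1 : R)%:C)%:M).
Proof. by move=> am; apply: mxmeasD => //; exact: mxmeas_cst. Qed.

(** The generalised inverse is the limit of a (a^2 + 1/(k+1))^-1, which
    vanishes on the kernel for every k. *)
Lemma mxmeas_pinv a : (forall x, psdmx (a x)) -> mxmeas a ->
  mxmeas (fun x => pinv (a x)).
Proof.
move=> a0 am; pose e k : C := (k.+1%:R^-1 : R)%:C.
have aa0 x : psdmx (a x *m a x).
  rewrite -(sfun_id (a0 x)) sfunM//; apply: sfun_psd => // z z0.
  exact: mulr_ge0.
have E k x : a x *m invmx (a x *m a x + (e k)%:M) =
    sfun (fun z => z * (z * z + e k)^-1) (a x).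
  have u : a x *m a x + (e k)%:M \in unitmx.
    by apply: psd_unitD => //; exact: harmonicC_gt0.
  have -> : invmx (a x *m a x + (e k)%:M) =
      sfun (fun z => (z * z + e k)^-1) (a x).
    apply: (can_inj (mulKmx u)); rewrite mulmxV//.
    rewrite -{1 2}(sfun_id (a0 x)) -(sfun_cst (e k) (a0 x)) sfunM// sfunD//.
    rewrite sfunM// -(sfun_cst 1 (a0 x)); apply: eq_sfun => // z z0.
    by rewrite mulfV// gt_eqF// ltr_wpDl ?mulr_ge0//; exact: harmonicC_gt0.
  by rewrite -{1}(sfun_id (a0 x)) sfunM.
apply: (@mxmeas_lim _ _ _ _ _
    (fun k x => a x *m invmx (a x *m a x + (e k)%:M))).
  move=> k; apply: mxmeasM => //; apply: mxmeas_invmx.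
    by move=> x; apply: psd_unitD => //; exact: harmonicC_gt0.
  by apply: mxmeas_reg; exact: mxmeasM.
move=> x.
suff cv : mxcvg \oo (fun k => sfun (fun z => z * (z * z + e k)^-1) (a x))
    (pinv (a x)).
  by apply: mxcvg_near cv; apply: nearW => k; rewrite E.
apply: mxcvg_sfun => // z z0.
by apply: (@cvg_reg_inv C nat \oo _ e); exact: harmonicC_cvg.
Qed.

Lemma mxmeas_gmean a b : (forall x, psdmx (a x)) -> (forall x, psdmx (b x)) ->
  mxmeas a -> mxmeas b -> mxmeas (fun x => gmean (a x) (b x)).
Proof.
move=> a0 b0 am bm; under [X in mxmeas X]eq_fun do rewrite gmean.unlock /=.
have sm := mxmeas_sqrtmx a0 am.
have s0 x := sqrtmx_psd (a0 x).
have tm := mxmeas_pinv s0 sm.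
apply: mxmeasM => //; apply: mxmeasM => //; apply: mxmeas_sqrtmx.
  by move=> x; apply: psd_congr_herm => //; exact: pinv_adj.
by do 2! apply: mxmeasM => //.
Qed.

(** The limit in e exists at every point, so it may be taken along 1/(k+1). *)
Lemma mxmeas_geomean a b : (forall x, psdmx (a x)) -> (forall x, psdmx (b x)) ->
  mxmeas a -> mxmeas b -> mxmeas (fun x => geomean (a x) (b x)).
Proof.
move=> a0 b0 am bm; pose e k : C := (k.+1%:R^-1 : R)%:C.
pose u x := (a x \in unitmx) && (b x \in unitmx).
apply: (@mxmeas_lim _ _ _ _ _ (fun k x => if u x then gmean (a x) (b x)
    else gmean (a x + (e k)%:M) (b x + (e k)%:M))).
  have e0 k : psdmx ((e k)%:M : 'M[C]_d).
    by apply: psd_scalar; exact/ltW/harmonicC_gt0.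
  move=> k; apply: mxmeas_if.
  - by apply: measurable_and; exact: measurable_unitmx.
  - exact: mxmeas_gmean.
  - by apply: mxmeas_gmean; try (by move=> x; exact: psdD); exact: mxmeas_reg.
move=> x; case: (geomeanP (a0 x) (b0 x)) => [au bu|L nu gL].
  by rewrite /u au bu; exact: mxcvg_cst.
rewrite /u (negbTE nu) => i j.
apply: cvg_comp (gL i j) => /= A A0.
have h := @cvg_harmonic R _ A0.
apply: (@filterS _ \oo _ _ _ _ h) => k /=; apply.
suff : 0 < (k.+1%:R^-1 : R) by [].
by rewrite invr_gt0.
Qed.

End measurable_functional_calculus.

(** * Change of variables along a scalar density *)

Section measures.
Context {R : realType} {disp : measure_display} {T : measurableType disp}.
Local Notation C := R[i].

Lemma finite_measure_of (mu : set T -> \bar R) : mu set0 = 0%E ->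
  (forall E, 0 <= mu E)%E -> semi_sigma_additive mu ->
  (forall E, measurable E -> mu E \is a fin_num) ->
  exists m : {finite_measure set T -> \bar R}, (m : set T -> \bar R) = mu.
Proof.
move=> mu0 mu_ge0 mus mufin.
pose M := isMeasure.Build _ T R mu mu0 mu_ge0 mus.
pose m : {measure set T -> \bar R} := HB.pack mu M.
pose N := Measure_isFinite.Build _ T R m mufin.
pose m' : {finite_measure set T -> \bar R} := HB.pack mu M N.
by exists m'.
Qed.

Section change_of_variables.
Variables (m1 m2 : {finite_measure set T -> \bar R}) (f : T -> R).
Hypothesis f0 : forall x, 0 <= f x.
Hypothesis fm : measurable_fun setT f.
Hypothesis m2E : forall E, measurable E ->
  m2 E = (\int[m1]_(x in E) (f x)%:E)%E.

(** By uniqueness f is almost everywhere the Radon-Nikodym derivative, for which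
    the change of variables holds. *)
Lemma density_ge0_integral (h : T -> R) E : (forall x, 0 <= h x) ->
  measurable E -> measurable_fun setT h ->
  (\int[m2]_(x in E) (h x)%:E = \int[m1]_(x in E) (f x * h x)%:E)%E.
Proof.
move=> h0 mE hm.
have dom : m2 `<< m1.
  apply/null_content_dominatesP => A mA A0.
  rewrite m2E// null_set_integral//.
  exact/measurable_EFinP/measurable_funTS.
pose g := Radon_Nikodym_SigmaFinite.f m2 m1.
have gi : m1.-integrable setT g := Radon_Nikodym_SigmaFinite.f_integrable dom.
have ae : ae_eq m1 setT g (EFin \o f).
  apply: integral_ae_eq => //; first exact/measurable_EFinP.
  by move=> A _ mA; rewrite -m2E// -Radon_Nikodym_SigmaFinite.f_integral.
rewrite -(Radon_Nikodym_SigmaFinite.change_of_variables dom)//; last first.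
  exact/measurable_EFinP/measurable_funTS.
apply: ae_eq_integral => //.
- apply: emeasurable_funM; first exact/measurable_EFinP/measurable_funTS.
  by apply: measurable_funTS; exact: measurable_int gi.
- by apply/measurable_EFinP/measurable_funTS; exact: measurable_funM.
apply: ae_eq_subset (@subsetT _ E) _.
move: ae; apply: filterS => x /= gx _; rewrite -/(g x) gx//.
by rewrite -EFinM mulrC.
Qed.

Lemma density_integrable (h : T -> R) :
  m2.-integrable setT (EFin \o h) ->
  m1.-integrable setT (EFin \o (fun x => f x * h x)).
Proof.
move=> /integrableP[/measurable_EFinP hm hfin]; apply/integrableP; split.
  by apply/measurable_EFinP; exact: measurable_funM.
move: hfin; rewrite (density_ge0_integral (fun x => normr_ge0 (h x)))//; last first.
  exact: measurableT_comp.
by under [X in _ -> (X < _)%E]eq_integral do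
  rewrite /= normrM (ger0_norm (f0 _)).
Qed.

(** The positive and negative parts of f h are f times those of h, as f is
    nonnegative. *)
Lemma density_integral (h : T -> R) E : measurable E ->
  measurable_fun setT h ->
  (\int[m2]_(x in E) (h x)%:E = \int[m1]_(x in E) (f x * h x)%:E)%E.
Proof.
move=> mE hm; rewrite integralE [RHS]integralE.
pose hp x := Num.max (h x) 0; pose hn x := Num.max (- h x) 0.
have hp0 x : 0 <= hp x by rewrite le_max lexx orbT.
have hn0 x : 0 <= hn x by rewrite le_max lexx orbT.
have posE (k : T -> R) : (fun x => (k x)%:E)^\+%E =
    (fun x => (Num.max (k x) 0)%:E) :> (T -> \bar R).
  by apply/funext => x; rewrite funeposE EFin_max.
have negE (k : T -> R) : (fun x => (k x)%:E)^\-%E =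
    (fun x => (Num.max (- k x) 0)%:E) :> (T -> \bar R).
  by apply/funext => x; rewrite funenegE EFin_max.
rewrite !posE !negE !density_ge0_integral//.
- by congr (_ - _)%E; apply: eq_integral => x _;
    rewrite maxr_pMr// ?mulrN mulr0.
- by apply: measurable_maxr; [exact: measurable_funN|exact: measurable_cst].
- by apply: measurable_maxr => //; exact: measurable_cst.
Qed.

End change_of_variables.
End measures.

(** * Integrals of complex functions *)

Section complex_integrals.
Context {R : realType} {disp : measure_display} {T : measurableType disp}.
Local Notation C := R[i].
Variable m : {measure set T -> \bar R}.
Implicit Types (f g : T -> C) (E : set T).

Lemma cintegrable_measurable f : cintegrable m f -> cmeasurable f.
Proof.
by move=> [/measurable_int/measurable_EFinP fr /measurable_int/measurable_EFinP fi].
Qed.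

Lemma cintegrable0 : cintegrable m (fun _ : T => 0).
Proof. by split; exact: integrable0. Qed.

Lemma cintegrableD f g : cintegrable m f -> cintegrable m g ->
  cintegrable m (fun x => f x + g x).
Proof.
move=> [fr fi] [gr gi]; split; under eq_fun do rewrite raddfD /= EFinD;
  exact: integrableD.
Qed.

Lemma cintegrableZ (c : C) f : cintegrable m f ->
  cintegrable m (fun x => c * f x).
Proof.
move=> [fr fi]; split.
  under eq_fun do rewrite complex_ReM EFinB !EFinM.
  by apply: integrableB => //; exact: integrableZl.
under eq_fun do rewrite complex_ImM EFinD !EFinM.
by apply: integrableD => //; exact: integrableZl.
Qed.

Lemma cintegrable_sum (J : Type) (r : seq J) (f : J -> T -> C) :
  (forall j, cintegrable m (f j)) -> cintegrable m (fun x => \sum_(j <- r) f j x).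
Proof.
move=> fj; elim: r => [|j r IH].
  by under eq_fun do rewrite big_nil; exact: cintegrable0.
by under eq_fun do rewrite big_cons; exact: cintegrableD.
Qed.

Lemma cintegralE E f : cintegral m E f =
  Rintegral m E (fun x => complex.Re (f x))
    +i* Rintegral m E (fun x => complex.Im (f x)).
Proof. by []. Qed.

Lemma cintegral0 E : cintegral m E (fun=> 0) = 0.
Proof. by rewrite /cintegral /= integral0. Qed.

Let restrict_int (h : T -> R) E : measurable E ->
  m.-integrable setT (EFin \o h) -> m.-integrable E (EFin \o h).
Proof. by move=> mE; exact: integrableS. Qed.

Lemma cintegralD E f g : measurable E -> cintegrable m f -> cintegrable m g ->
  cintegral m E (fun x => f x + g x) = cintegral m E f + cintegral m E g.
Proof.
move=> mE [fr fi] [gr gi]; rewrite !cintegralE.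
under eq_Rintegral do rewrite raddfD /=.
under [X in _ +i* X]eq_Rintegral do rewrite raddfD /=.
by rewrite !RintegralD//; exact: restrict_int.
Qed.

Lemma cintegralZ E (c : C) f : measurable E -> cintegrable m f ->
  cintegral m E (fun x => c * f x) = c * cintegral m E f.
Proof.
move=> mE [fr fi]; rewrite !cintegralE.
have Zi (a : R) (h : T -> R) : m.-integrable setT (EFin \o h) ->
    m.-integrable E (EFin \o (fun x => a * h x)).
  move=> hi; apply: restrict_int => //.
  rewrite (_ : _ \o _ = fun x => (a%:E * (h x)%:E)%E); first exact: integrableZl.
  by apply/funext => x /=; rewrite EFinM.
under eq_Rintegral do rewrite complex_ReM.
under [X in _ +i* X]eq_Rintegral do rewrite complex_ImM.
rewrite RintegralB ?RintegralD//; try exact: Zi.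
rewrite !RintegralZl//; try exact: restrict_int.
by case: c.
Qed.

Lemma cintegral_sum E (J : Type) (r : seq J) (f : J -> T -> C) :
  measurable E -> (forall j, cintegrable m (f j)) ->
  cintegral m E (fun x => \sum_(j <- r) f j x) = \sum_(j <- r) cintegral m E (f j).
Proof.
move=> mE fj; elim: r => [|j r IH].
  by under eq_fun do rewrite big_nil; rewrite big_nil cintegral0.
under eq_fun do rewrite big_cons.
by rewrite big_cons cintegralD// ?IH//; exact: cintegrable_sum.
Qed.

Let indicE (h : T -> R) E :
  (fun x => (\1_E x * h x)%:E) = (EFin \o h) \_ E :> (T -> \bar R).
Proof.
apply/funext => x; rewrite patchE indicE /=.
by case: (x \in E); rewrite ?mul1r ?mul0r.
Qed.

Let ReI (x : T) E (z : C) : complex.Re ((\1_E x)%:C * z) = \1_E x * complex.Re z.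
Proof. by rewrite complex_ReM /= mul0r subr0. Qed.

Let ImI (x : T) E (z : C) : complex.Im ((\1_E x)%:C * z) = \1_E x * complex.Im z.
Proof. by rewrite complex_ImM /= mul0r addr0. Qed.

Lemma cintegrable_indic E f : measurable E -> cintegrable m f ->
  cintegrable m (fun x => (\1_E x)%:C * f x).
Proof.
move=> mE [fr fi]; split.
  under eq_fun do rewrite ReI; rewrite indicE.
  by apply/(integrable_mkcond _ mE); exact: (restrict_int mE fr).
under eq_fun do rewrite ImI; rewrite indicE.
by apply/(integrable_mkcond _ mE); exact: (restrict_int mE fi).
Qed.

Lemma cintegral_indic E f : measurable E ->
  cintegral m setT (fun x => (\1_E x)%:C * f x) = cintegral m E f.
Proof.
move=> mE; rewrite /cintegral.
have hr : (fun x => (complex.Re ((\1_E x)%:C * f x))%:E) =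
    (EFin \o (fun x => complex.Re (f x))) \_ E.
  by rewrite -indicE; apply/funext => x; rewrite ReI.
have hi : (fun x => (complex.Im ((\1_E x)%:C * f x))%:E) =
    (EFin \o (fun x => complex.Im (f x))) \_ E.
  by rewrite -indicE; apply/funext => x; rewrite ImI.
by rewrite hr hi -!integral_mkcond.
Qed.

Lemma cintegral_ae_eq f g : cintegrable m f -> cintegrable m g ->
  (forall E, measurable E -> cintegral m E f = cintegral m E g) ->
  \forall x \ae m, f x = g x.
Proof.
have key (h k : T -> R) : m.-integrable setT (EFin \o h) ->
    m.-integrable setT (EFin \o k) ->
    (forall E, measurable E -> Rintegral m E h = Rintegral m E k) ->
    \forall x \ae m, h x = k x.
  move=> hi ki hk.
  have : ae_eq m setT (EFin \o h) (EFin \o k).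
    apply: integral_ae_eq => //; first exact: measurable_int ki.
    move=> E _ mE; have := hk _ mE; rewrite /Rintegral.
    have hf : (\int[m]_(x in E) (EFin \o h) x)%E \is a fin_num.
      by apply: integrable_fin_num => //; exact: restrict_int.
    have kf : (\int[m]_(x in E) (EFin \o k) x)%E \is a fin_num.
      by apply: integrable_fin_num => //; exact: restrict_int.
    by move=> hE; have := congr1 (@EFin R) hE; rewrite !fineK.
  by apply: filterS => x hx; case: (hx I).
move=> [fr fi] [gr gi] fg.
have r := key _ _ fr gr; have i := key _ _ fi gi.
have {}r := r (fun E mE => congr1 (@complex.Re R) (fg E mE)).
have {}i := i (fun E mE => congr1 (@complex.Im R) (fg E mE)).
apply: filterS2 r i => x rx ix.
by apply/eqP; rewrite eq_complex rx ix !eqxx.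
Qed.

Lemma ae_cintegrable f g : cmeasurable g -> cintegrable m f ->
  (\forall x \ae m, f x = g x) -> cintegrable m g.
Proof.
have key (h k : T -> R) : measurable_fun setT k ->
    m.-integrable setT (EFin \o h) -> (\forall x \ae m, h x = k x) ->
    m.-integrable setT (EFin \o k).
  move=> km /integrableP[/measurable_EFinP hm hfin] hk; apply/integrableP.
  split; first exact/measurable_EFinP.
  suff -> : (\int[m]_x `|(EFin \o k) x| = \int[m]_x `|(EFin \o h) x|)%E by [].
  apply: ae_eq_integral => //.
  - by apply: measurableT_comp => //; exact/measurable_EFinP.
  - by apply: measurableT_comp => //; exact/measurable_EFinP.
  - by apply: filterS hk => x /= ->.
move=> [gr gi] [fr fi] fg; split.
  by apply: key fr _ => //; apply: filterS fg => x ->.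
by apply: key fi _ => //; apply: filterS fg => x ->.
Qed.

Lemma ae_cintegral E f g : measurable E -> cmeasurable f -> cmeasurable g ->
  (\forall x \ae m, f x = g x) -> cintegral m E f = cintegral m E g.
Proof.
move=> mE [fr fi] [gr gi] fg; rewrite /cintegral.
congr (fine _ +i* fine _); apply: ae_eq_integral => //;
  try exact/measurable_EFinP/measurable_funTS;
  by apply: filterS fg => x -> _.
Qed.

End complex_integrals.

Section complex_change_of_variables.
Context {R : realType} {disp : measure_display} {T : measurableType disp}.
Local Notation C := R[i].
Variables (m1 m2 : {finite_measure set T -> \bar R}) (f : T -> R).
Hypothesis f0 : forall x, 0 <= f x.
Hypothesis fm : measurable_fun setT f.
Hypothesis m2E : forall E, measurable E ->
  m2 E = (\int[m1]_(x in E) (f x)%:E)%E.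

Let ReZ (a : R) (z : C) : complex.Re (a%:C * z) = a * complex.Re z.
Proof. by rewrite complex_ReM /= mul0r subr0. Qed.

Let ImZ (a : R) (z : C) : complex.Im (a%:C * z) = a * complex.Im z.
Proof. by rewrite complex_ImM /= mul0r addr0. Qed.

Lemma density_cintegrable (h : T -> C) : cintegrable m2 h ->
  cintegrable m1 (fun x => (f x)%:C * h x).
Proof.
move=> [hr hi]; split.
  under eq_fun do rewrite ReZ; exact: (density_integrable f0 fm m2E hr).
under eq_fun do rewrite ImZ; exact: (density_integrable f0 fm m2E hi).
Qed.

Lemma density_cintegral (h : T -> C) E : measurable E -> cmeasurable h ->
  cintegral m2 E h = cintegral m1 E (fun x => (f x)%:C * h x).
Proof.
move=> mE [hr hi]; rewrite /cintegral.
rewrite (density_integral f0 fm m2E mE hr) (density_integral f0 fm m2E mE hi).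
by congr (fine _ +i* fine _); apply: eq_integral => x _; rewrite (ReZ, ImZ).
Qed.

End complex_change_of_variables.

(** * States and matrix valued densities *)

Section states.
Context {C : numClosedFieldType} {d : nat}.
Implicit Types (a : 'M[C]_d).

(** States span all operators: an operator is a combination of two Hermitian
    ones, and these are combinations of the rank one projections onto their
    eigenvectors. *)
Lemma state_ind (P : 'M[C]_d -> Prop) : P 0 ->
  (forall a b, P a -> P b -> P (a + b)) -> (forall c a, P a -> P (c *: a)) ->
  (forall rho, psdmx rho /\ \tr rho = 1 -> P rho) -> forall a, P a.
Proof.
move=> P0 PD PZ PS.
have PH (H : 'M[C]_d) : H^t* = H -> P H.
  move=> /herm_spectral[U [l [Uu _ ->]]].
  rewrite diag_mx_sum_delta mulmx_sumr mulmx_suml.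
  elim/big_ind : _ => // k _; rewrite -scalemxAr -scalemxAl; apply: PZ; apply: PS.
  split.
    have -> : delta_mx k k = diag_mx (delta_mx 0 k : 'rV[C]_d).
      apply/matrixP => i j; rewrite !mxE eqxx /=.
      by case: eqVneq => [->|]; case: eqVneq => //= _ _; case: eqVneq.
    by apply: psd_diag => i; rewrite mxE ler0n.
  rewrite mxtrace_mulC mulmxA (unitarymxP Uu) mul1mx /mxtrace (bigD1 k)//= mxE.
  by rewrite !eqxx big1 ?addr0// => i /negbTE ik; rewrite mxE ik.
move=> a.
have ii : 'i * 'i = -1 :> C by rewrite -expr2 sqrCi.
have -> : a = 2^-1 *: ((a + a^t*) + 'i *: ('i *: (a^t* - a))).
  rewrite scalerA ii scaleN1r opprB addrACA subrr addr0.
  by rewrite -[a + a]mulr2n -[a *+ 2]scaler_nat scalerA mulVf ?scale1r ?pnatr_eq0.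
apply/PZ/PD; first by apply: PH; rewrite adjmxD trmxCK addrC.
apply/PZ/PH; rewrite adjmxZ adjmxB trmxCK conjCi scaleNr -scalerN opprB.
by [].
Qed.

Lemma tr_delta (W : 'M[C]_d) i j : \tr (delta_mx j i *m W) = W i j.
Proof.
rewrite /mxtrace (bigD1 j)//= mxE (bigD1 i)//= mxE !eqxx mul1r.
rewrite [X in _ + X + _]big1 ?addr0 => [|k /negbTE ki]; last first.
  by rewrite mxE ki andbF mul0r.
rewrite big1 ?addr0// => k /negbTE kj; rewrite mxE big1// => l _.
by rewrite mxE kj mul0r.
Qed.

Lemma psd_tr_ge0 a : psdmx a -> 0 <= \tr a.
Proof.
move=> a0; rewrite /mxtrace sumr_ge0// => i _; rewrite mx_entryE; exact: a0.
Qed.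

Lemma psd_tr0 a : psdmx a -> \tr a = 0 -> a = 0.
Proof.
move=> /psdP[U l Uu l0 -> _].
rewrite mxtrace_mulC mulmxA (unitarymxP Uu) mul1mx mxtrace_diag.
move=> /eqP; rewrite psumr_eq0// => /allP h.
have -> : l = 0.
  by apply/matrixP => i j; rewrite ord1 mxE; have /eqP := h j (mem_index_enum j).
by rewrite linear0 mulmx0 mul0mx.
Qed.

End states.

Section matrix_densities.
Context {R : realType} {disp : measure_display} {T : measurableType disp}.
Context {d : nat}.
Local Notation C := R[i].
Implicit Types (W psi A : T -> 'M[C]_d) (kappa nu : set T -> 'M[C]_d).

Lemma qmeasurableP psi : qmeasurable T psi <-> mxmeas psi.
Proof.
split=> [qm i j|pm rho _].
  under eq_fun do rewrite -(tr_delta (psi _)).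
  move: (delta_mx j i); apply: state_ind => //.
  - by under eq_fun do rewrite mul0mx mxtrace0; exact: cmeasurable_cst.
  - move=> a b am bm; under eq_fun do rewrite mulmxDl linearD /=.
    exact: cmeasurableD.
  - move=> c a am; under eq_fun do rewrite -scalemxAl linearZ /=.
    by apply: cmeasurableM => //; exact: cmeasurable_cst.
apply: cmeasurable_sum => i.
have := mxmeasM (@mxmeas_cst _ _ T _ _ rho) pm; exact.
Qed.

Section fixed_measure.
Variable m : {measure set T -> \bar R}.

Definition mxintegrable W := forall i j, cintegrable m (fun x => W x i j).

Definition mxintegral E W : 'M[C]_d :=
  \matrix_(i, j) cintegral m E (fun x => W x i j).

Lemma mxintegrable_meas W : mxintegrable W -> mxmeas W.
Proof. by move=> Wi i j; exact: cintegrable_measurable. Qed.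

Lemma tr_mulE (rho : 'M[C]_d) (w : 'M[C]_d) :
  \tr (rho *m w) = \sum_i \sum_j rho i j * w j i.
Proof. by apply: eq_bigr => i _; rewrite mxE. Qed.

Lemma mxintegrable_tr W rho : mxintegrable W ->
  cintegrable m (fun x => \tr (rho *m W x)).
Proof.
move=> Wi; under eq_fun do rewrite tr_mulE.
by do 2! apply: cintegrable_sum => ?; exact: cintegrableZ.
Qed.

Lemma mxintegral_tr E W rho : measurable E -> mxintegrable W ->
  cintegral m E (fun x => \tr (rho *m W x)) = \tr (rho *m mxintegral E W).
Proof.
move=> mE Wi; under eq_fun do rewrite tr_mulE.
rewrite cintegral_sum// => [|i]; last first.
  by apply: cintegrable_sum => j; exact: cintegrableZ.
rewrite tr_mulE; apply: eq_bigr => i _.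
rewrite cintegral_sum// => [|j]; last exact: cintegrableZ.
by apply: eq_bigr => j _; rewrite cintegralZ// mxE.
Qed.

Lemma mxintegrable_state W :
  (forall rho, state rho -> cintegrable m (fun x => \tr (rho *m W x))) ->
  mxintegrable W.
Proof.
move=> Wi i j; under eq_fun do rewrite -(tr_delta (W _)).
move: (delta_mx j i); apply: state_ind => //.
- by under eq_fun do rewrite mul0mx mxtrace0; exact: cintegrable0.
- move=> a b am bm; under eq_fun do rewrite mulmxDl linearD /=.
  exact: cintegrableD.
- move=> c a am; under eq_fun do rewrite -scalemxAl linearZ /=.
  exact: cintegrableZ.
Qed.

Lemma state_eq (a b : 'M[C]_d) :
  (forall rho, state rho -> \tr (rho *m a) = \tr (rho *m b)) -> a = b.
Proof.
move=> ab; apply/matrixP => i j; rewrite -!(tr_delta _ i j).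
move: (delta_mx j i); apply: state_ind => //.
- by rewrite !mul0mx.
- by move=> r s ra sa; rewrite !mulmxDl !linearD /= ra sa.
- by move=> c r ra; rewrite -!scalemxAl !linearZ /= ra.
Qed.

(** The matrix analogue of an absolutely continuous measure: kappa = W m.  All
    the operator valued measures of the theorem are compared through such
    densities with respect to a scalar measure. *)
Definition mxdensity W kappa :=
  mxintegrable W /\ forall E, measurable E -> kappa E = mxintegral E W.

Lemma mxdensity_unique W W' kappa : mxdensity W kappa -> mxdensity W' kappa ->
  \forall x \ae m, W x = W' x.
Proof.
move=> [Wi WE] [W'i W'E].
have h (ij : 'I_d * 'I_d) : \forall x \ae m, W x ij.1 ij.2 = W' x ij.1 ij.2.
  apply: cintegral_ae_eq => // E mE.
  have := congr1 (fun M : 'M[C]_d => M ij.1 ij.2) (esym (WE _ mE)).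
  by rewrite /= W'E// !mxE.
have h2 : \forall x \ae m, forall ij : 'I_d * 'I_d,
    W x ij.1 ij.2 = W' x ij.1 ij.2 by exact: filter_forall.
by apply: filterS h2 => x hx; apply/matrixP => i j; exact: (hx (i, j)).
Qed.

Lemma mxdensity_ae W W' kappa : mxmeas W' -> mxdensity W kappa ->
  (\forall x \ae m, W x = W' x) -> mxdensity W' kappa.
Proof.
move=> W'm [Wi WE] WW'.
have e i j : \forall x \ae m, W x i j = W' x i j.
  by apply: filterS WW' => x ->.
split=> [i j|E mE]; first exact: (ae_cintegrable (W'm i j) (Wi i j) (e i j)).
rewrite WE//; apply/matrixP => i j; rewrite !mxE.
by apply: ae_cintegral => //; exact: mxintegrable_meas.
Qed.

End fixed_measure.

End matrix_densities.

(** * Trace measures and quantum integrals *)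

(** When A is d nu / d mu_nu, this is the density of the quantum integral of psi
    against nu with respect to mu_nu. *)
Definition sandwich {R : realType} {d : nat} {X : Type}
    (A psi : X -> 'M[R[i]]_d) x := sqrtmx (A x) *m psi x *m sqrtmx (A x).

Section povm_measures.
Context {R : realType} {disp : measure_display} {T : measurableType disp}.
Context {d : nat}.
Local Notation C := R[i].
Implicit Types (W psi A : T -> 'M[C]_d) (kappa nu : set T -> 'M[C]_d).

Lemma trace_measureE nu E : measurable E ->
  trace_measure T nu E = (complex.Re (\tr (nu E)) / d%:R)%:E.
Proof. by move=> mE; rewrite /trace_measure; case: asboolP. Qed.

Lemma trace_measureNE nu E : ~ measurable E -> trace_measure T nu E = 0%E.
Proof. by move=> mE; rewrite /trace_measure; case: asboolP. Qed.

Lemma trace_measure_fin nu E : trace_measure T nu E \is a fin_num.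
Proof. by rewrite /trace_measure; case: ifP. Qed.

Lemma povm_tr_Re nu E : is_povm T nu -> measurable E ->
  \tr (nu E) = (complex.Re (\tr (nu E)))%:C.
Proof.
move=> [nu0 _ _] mE; rewrite RRe_real//; apply/ger0_real/psd_tr_ge0.
exact: nu0.
Qed.

Lemma povm_dim nu : is_povm T nu -> (0 < d)%N.
Proof.
move=> [_ nuT _]; rewrite lt0n; apply/eqP => d0.
by apply: nuT; apply/matrixP => i j; exfalso; move: (ltn_ord i); rewrite {2}d0.
Qed.

(** Additivity comes from testing with rho = 1.  The empty set gets measure 0
    because n c tends to c only for c = 0. *)
Lemma povm_finite_measure nu : is_povm T nu ->
  exists m : {finite_measure set T -> \bar R},
    (m : set T -> \bar R) = trace_measure T nu.
Proof.
move=> nuP; have [nu0 _ nus] := nuP.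
have nus1 (E : nat -> set T) : (forall k, measurable (E k)) ->
    trivIset [set: nat] E ->
    (\sum_(k < n) complex.Re (\tr (nu (E k)))) @[n --> \oo] -->
    complex.Re (\tr (nu (\bigcup_k E k))).
  move=> mE tE; have /cvg_complexP[+ _] := nus E mE tE 1%:M.
  rewrite mul1mx; under eq_fun do rewrite raddf_sum /=.
  by under eq_fun do under eq_bigr do rewrite mul1mx.
apply: finite_measure_of => [|E|E mE tE mUE|E _]; last exact: trace_measure_fin.
- rewrite trace_measureE//; set c := complex.Re _.
  have h : (c *+ n) @[n --> \oo] --> c.
    have t0 : trivIset [set: nat] (fun=> set0 : set T).
      by move=> i j _ _ [x []].
    have := nus1 (fun=> set0) (fun=> measurable0) t0.
    rewrite bigcup0// -/c; under eq_fun do rewrite big_const_ord iter_addr_0.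
    by [].
  have h' : (c *+ n.+1) @[n --> \oo] --> c by rewrite -(cvg_shiftS) in h.
  have : (c *+ n.+1 - c *+ n) @[n --> \oo] --> c - c by exact: cvgB.
  under eq_fun do rewrite mulrS addrK.
  rewrite subrr => cc; have := cvg_unique _ cc (@cvg_cst _ c _ _ _).
  by move=> <- //; rewrite mul0r.
- have [mE|/trace_measureNE->//] := pselect (measurable E).
  rewrite trace_measureE// lee_fin divr_ge0// -lecR -povm_tr_Re//.
  exact/psd_tr_ge0/nu0.
- rewrite (_ : (fun n => _) = fun n =>
      ((\sum_(k < n) complex.Re (\tr (nu (E k)))) / d%:R)%:E); last first.
    apply/funext => n; rewrite big_mkord mulr_suml -sumEFin.
    by apply: eq_bigr => k _; rewrite trace_measureE.
  rewrite trace_measureE//; apply: cvg_EFin; first exact: nearW.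
  by apply: cvgMl; exact: nus1.
Qed.

(** The trace of kappa is additive because it is an integral of f, and finite
    because it is the trace of an operator. *)
Lemma trace_deriv_finite_measure nu1 kappa (f : T -> R)
    (m1 : {finite_measure set T -> \bar R}) :
  (m1 : set T -> \bar R) = trace_measure T nu1 ->
  is_trace_deriv T nu1 kappa f ->
  exists m : {finite_measure set T -> \bar R},
    (m : set T -> \bar R) = trace_measure T kappa.
Proof.
move=> m1E [f0 fm fE]; rewrite -m1E in fE.
apply: finite_measure_of => [|E|E mE tE mUE|E _]; last exact: trace_measure_fin.
- by rewrite fE// integral_set0.
- have [mE|/trace_measureNE->//] := pselect (measurable E).
  by rewrite fE// integral_ge0// => x _; rewrite lee_fin.
- rewrite fE// ge0_integral_bigcup//; last 2 first.
    exact/measurable_EFinP/measurable_funTS.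
    by move=> x _; rewrite lee_fin.
  rewrite (_ : (fun n => _) = fun n =>
      (\sum_(0 <= i < n) \int[m1]_(x in E i) (f x)%:E)%E); last first.
    by apply/funext => n; apply: eq_bigr => k _; rewrite fE.
  apply: is_cvg_ereal_nneg_natsum => k _.
  by apply: integral_ge0 => x _; rewrite lee_fin.
Qed.

(** A positive operator of trace 0 is 0, so nu and its trace have the same null
    sets. *)
Lemma povm_aeP nu (m : {finite_measure set T -> \bar R}) (P : T -> Prop) :
  is_povm T nu -> (m : set T -> \bar R) = trace_measure T nu ->
  povm_ae T nu P <-> \forall x \ae m, P x.
Proof.
move=> nuP mE; split=> [[N [mN N0 PN]]|[N [mN N0 PN]]].
  by exists N; split=> //; rewrite mE trace_measureE// N0 mxtrace0 /= mul0r.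
exists N; split=> //; apply: psd_tr0; first by have [nu0 _ _] := nuP; exact: nu0.
have d0 := povm_dim nuP.
move: N0; rewrite mE trace_measureE// => -[/eqP].
rewrite mulf_eq0 invr_eq0 pnatr_eq0 (gtn_eqF d0) orbF => /eqP N0.
by rewrite (povm_tr_Re nuP)// N0.
Qed.

Section fixed_trace_measure.
Variables (nu : set T -> 'M[C]_d) (m : {finite_measure set T -> \bar R}).
Hypothesis mE : (m : set T -> \bar R) = trace_measure T nu.
Variable A : T -> 'M[C]_d.

Lemma qdensityE psi rho :
  qdensity A psi rho = (fun x => \tr (rho *m sandwich A psi x)).
Proof. by apply/funext => x; rewrite /qdensity sqrtmE. Qed.

Lemma qintegrableP psi : qintegrable T nu A psi <->
  mxintegrable m (sandwich A psi).
Proof.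
rewrite /qintegrable -mE; split=> [qi|Wi rho _].
  apply: mxintegrable_state => rho rs.
  by rewrite -qdensityE; exact: qi.
by rewrite qdensityE; exact: mxintegrable_tr.
Qed.

(** The integral of the sandwich satisfies the defining property, and states
    separate operators. *)
Lemma qexpE psi : mxintegrable m (sandwich A psi) ->
  qexp T nu A psi = mxintegral m setT (sandwich A psi).
Proof.
move=> Wi; apply: state_eq => rho rs.
have h : [set M | forall r, state r -> \tr (r *m M) =
    cintegral m setT (qdensity A psi r)] (qexp T nu A psi).
  rewrite /qexp -mE; apply: xgetPex; exists (mxintegral m setT (sandwich A psi)).
  by move=> r _ /=; rewrite qdensityE mxintegral_tr.
by rewrite (h rho rs) qdensityE mxintegral_tr.
Qed.

Lemma qintegralE psi E : measurable E -> mxintegrable m (sandwich A psi) ->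
  qintegral T nu A E psi = mxintegral m E (sandwich A psi).
Proof.
move=> mE' Wi.
have sE x : sandwich A (fun x => (\1_E x)%:C *: psi x) x =
    (\1_E x)%:C *: sandwich A psi x.
  by rewrite /sandwich -scalemxAr -scalemxAl.
rewrite /qintegral qexpE.
  apply/matrixP => i j.
  have h := @cintegral_indic _ _ _ m E (fun x => sandwich A psi x i j) mE'.
  rewrite [RHS]mxE; apply: etrans h; rewrite mxE.
  by congr cintegral; apply/funext => x; rewrite sE mxE.
move=> i j; under eq_fun do rewrite sE mxE.
exact: (cintegrable_indic mE' (Wi i j)).
Qed.

Lemma sandwich_density psi kappa : qintegrable T nu A psi ->
  (forall E, measurable E -> kappa E = qintegral T nu A E psi) ->
  mxdensity m (sandwich A psi) kappa.
Proof.
move=> /qintegrableP Wi kE; split=> // E mE'.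
by rewrite kE// qintegralE.
Qed.

Lemma mxdensity_change nu2 kappa W (f : T -> R)
    (m2 : {finite_measure set T -> \bar R}) :
  (m2 : set T -> \bar R) = trace_measure T nu2 -> is_trace_deriv T nu nu2 f ->
  mxdensity m2 W kappa -> mxdensity m (fun x => (f x)%:C *: W x) kappa.
Proof.
move=> m2E [f0 fm fE] [Wi WE]; rewrite -m2E -mE in fE.
split=> [i j|E mE'].
  under eq_fun do rewrite mxE; exact: (density_cintegrable f0 fm fE).
rewrite WE//; apply/matrixP => i j; rewrite !mxE.
rewrite (density_cintegral f0 fm fE mE' (cintegrable_measurable (Wi i j))).
by congr cintegral; apply/funext => x; rewrite mxE.
Qed.

Lemma trace_deriv_density kappa B (f : T -> R) : is_density T kappa B ->
  is_trace_deriv T nu kappa f ->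
  mxdensity m (fun x => (f x)%:C *: B x) kappa.
Proof.
move=> [_ _ Bi BE] fd; have [m2 m2E] := trace_deriv_finite_measure mE fd.
apply: (mxdensity_change m2E fd); rewrite -m2E in Bi BE.
by split=> // E mE'; rewrite BE.
Qed.

End fixed_trace_measure.

End povm_measures.

(** * The product boxtimes at a point *)

Section range_projection.
Context {C : numClosedFieldType} {d : nat}.
Implicit Types (a q S psi : 'M[C]_d).

Lemma sqrtmx_rangep a : psdmx a -> sqrtmx a *m rangep a = sqrtmx a.
Proof.
move=> a0; rewrite -rangepEV// mulmxA; exact: pinv_mulK (sqrtmx_psd a0).
Qed.

Lemma sqrtmxZ (c : C) a : 0 <= c -> psdmx a ->
  sqrtmx (c *: a) = sqrtC c *: sqrtmx a.
Proof.
move=> c0 a0; rewrite -[in LHS](sfun_id a0) sfunZ// /sqrtmx sfun_comp// sfunZ//.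
by apply: eq_sfun => // z z0 /=; rewrite rootCMl.
Qed.

(** Since a^(1/2) (1 - P) = 0, the square of S vanishes on the complement of
    the range of a, and so does S. *)
Lemma rangep_absorb a q : psdmx a -> psdmx q ->
  let S := sqrtmx (sqrtmx a *m q *m sqrtmx a) in
  S *m rangep a = S /\ rangep a *m S = S.
Proof.
move=> a0 q0 S.
have sq0 : psdmx (sqrtmx a *m q *m sqrtmx a).
  by apply: psd_congr_herm => //; exact: sqrtmx_adj.
have P0 : psdmx (rangep a) by apply: sfun_psd => // z _; exact: ler0n.
have SH : S^t* = S by exact: sqrtmx_adj.
have SP : S *m rangep a = S.
  have : S *m (1%:M - rangep a) = 0.
    apply: congr_eq0 => //; rewrite -mulmxA.
    by rewrite -!mulmxA mulmxBr mulmx1 sqrtmx_rangep// subrr !mulmx0.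
  by move/eqP; rewrite mulmxBr mulmx1 subr_eq0 => /eqP.
by split=> //; rewrite -{1}SH -(psd_adj P0) -adjmxM SP.
Qed.

Lemma compress_sandwich a q : psdmx a ->
  pinv (sqrtmx a) *m (sqrtmx a *m q *m sqrtmx a) *m pinv (sqrtmx a) =
    rangep a *m q *m rangep a.
Proof.
by move=> a0; rewrite !mulmxA rangepEV// -!mulmxA rangepE.
Qed.

Lemma compress_mul (P s t S psi : 'M[C]_d) : s *m t = P -> t *m s = P ->
  S *m P = S -> P *m S = S ->
  (t *m S *m t) *m s *m psi *m s *m (t *m S *m t) =
    t *m (S *m psi *m S) *m t.
Proof.
move=> st ts SP PS.
rewrite -!mulmxA (mulmxA t s) ts (mulmxA s t) st (mulmxA P S) PS.
by rewrite (mulmxA S P) SP.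
Qed.

End range_projection.

Section boxtimes_formula.
Context {R : realType} {d : nat} {X : Type}.
Local Notation C := R[i].
Implicit Types (A phi psi : X -> 'M[C]_d).

(** The closed formula for the derivative, up to the scalar factor: b between two
    generalised inverses of a^(1/2). *)
Definition compress (a b : 'M[C]_d) := pinv (sqrtmx a) *m b *m pinv (sqrtmx a).

Lemma compressZ (c : C) (a b : 'M[C]_d) :
  compress a (c *: b) = c *: compress a b.
Proof. by rewrite /compress -scalemxAr -scalemxAl. Qed.

(** The geometric mean equals t S t with t the generalised inverse of A^(1/2),
    and S absorbs the projections t A^(1/2) and A^(1/2) t that surround psi. *)
Lemma boxtimesE A phi psi x : psdmx (A x) -> psdmx (phi x) ->
  rangep (A x) *m phi x *m rangep (A x) = phi x ->
  let S := sqrtmx (sqrtmx (A x) *m phi x *m sqrtmx (A x)) in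
  boxtimes A phi psi x = compress (A x) (S *m psi x *m S) /\
  sqrtmx (A x) *m compress (A x) (S *m psi x *m S) *m sqrtmx (A x)
    = S *m psi x *m S.
Proof.
move=> a0 q0 PqP S; have [SP PS] := rangep_absorb a0 q0.
rewrite -/S in SP PS; split.
  rewrite /boxtimes ginvE sqrtmE geomean_formula// -/S /compress.
  exact: (compress_mul _ (rangepE a0) (rangepEV a0) SP PS).
rewrite /compress !mulmxA rangepE// PS.
by rewrite -!mulmxA rangepEV// SP.
Qed.

(** It holds for the regularised limit too, since limits of positive operators
    are positive. *)
Lemma boxtimes_psd A phi psi x : psdmx (A x) -> psdmx (phi x) ->
  psdmx (psi x) -> psdmx (boxtimes A phi psi x).
Proof.
move=> a0 q0 psi0; rewrite /boxtimes ginvE sqrtmE.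
move: (geomean_psd (pinv_psd a0) q0) (sqrtmx_psd a0).
move: (geomean _ _) (sqrtmx _) => G s G0 s0.
have -> : G *m s *m psi x *m s *m G = G *m (s *m psi x *m s) *m G.
  by rewrite !mulmxA.
by apply: psd_congr_herm; [|apply: psd_congr_herm]; rewrite ?psd_adj.
Qed.

End boxtimes_formula.

(** * Scalar derivatives and the product boxtimes *)

Section absolutely_continuous_pairs.
Context {R : realType} {disp : measure_display} {T : measurableType disp}.
Context {d : nat}.
Local Notation C := R[i].
Implicit Types (A B phi psi W : T -> 'M[C]_d) (nu kappa : set T -> 'M[C]_d).

(** Only the values of kappa on measurable sets matter, although kappa is given on
    all sets: the trace measure is 0 on the others. *)
Lemma is_qRN_eq nu A kappa kappa' phi :
  (forall E, measurable E -> kappa E = kappa' E) ->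
  is_qRN T nu A kappa phi -> is_qRN T nu A kappa' phi.
Proof.
move=> kk' [qm qi qE [B [f [[B0 Bm Bi BE] [f0 fm fE] phiE]]]].
have tE : trace_measure T kappa = trace_measure T kappa'.
  apply/funext => E; have [mE|mE] := pselect (measurable E).
    by rewrite !trace_measureE// kk'.
  by rewrite !trace_measureNE.
split=> //; first by move=> E mE; rewrite -kk'// qE.
exists B, f; split=> //; rewrite tE in Bi BE fE; split=> // E mE.
by rewrite -kk'// BE.
Qed.

Lemma povm_ae_ac nu nu' (P : T -> Prop) : povm_ac T nu' nu ->
  povm_ae T nu P -> povm_ae T nu' P.
Proof. by move=> ac [N [mN N0 PN]]; exists N; split=> //; exact: ac. Qed.

Lemma mxmeas_compress A B : (forall x, psdmx (A x)) -> mxmeas A -> mxmeas B ->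
  mxmeas (fun x => compress (A x) (B x)).
Proof.
move=> A0 Am Bm.
have tm := mxmeas_pinv (fun x => sqrtmx_psd (A0 x)) (mxmeas_sqrtmx A0 Am).
exact: (mxmeasM (mxmeasM tm Bm) tm).
Qed.

Lemma mxmeas_sandwich A W : (forall x, psdmx (A x)) -> mxmeas A -> mxmeas W ->
  mxmeas (sandwich A W).
Proof.
move=> A0 Am Wm; have sm := mxmeas_sqrtmx A0 Am.
exact: (mxmeasM (mxmeasM sm Wm) sm).
Qed.

Lemma mxmeas_boxtimes A phi psi : (forall x, psdmx (A x)) ->
  (forall x, psdmx (phi x)) -> mxmeas A -> mxmeas phi -> mxmeas psi ->
  mxmeas (boxtimes A phi psi).
Proof.
move=> A0 phi0 Am phim psim.
have E : boxtimes A phi psi = fun x =>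
    geomean (pinv (A x)) (phi x) *m sqrtmx (A x) *m psi x *m sqrtmx (A x)
      *m geomean (pinv (A x)) (phi x).
  by apply/funext => x; rewrite /boxtimes ginvE sqrtmE.
rewrite E; have sm := mxmeas_sqrtmx A0 Am.
have Gm := mxmeas_geomean (fun x => pinv_psd (A0 x)) phi0
  (mxmeas_pinv A0 Am) phim.
exact: (mxmeasM (mxmeasM (mxmeasM (mxmeasM Gm sm) psim) sm) Gm).
Qed.

(** The integral identity and the closed formula of the derivative, both read
    pointwise. *)
Lemma qRN_ae nu (m : {finite_measure set T -> \bar R}) A kappa phi :
  is_povm T nu -> (m : set T -> \bar R) = trace_measure T nu ->
  is_qRN T nu A kappa phi ->
  exists B f, [/\ is_density T kappa B, is_trace_deriv T nu kappa f,
    \forall x \ae m, sandwich A phi x = (f x)%:C *: B x &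
    \forall x \ae m, phi x = (f x)%:C *: compress (A x) (B x)].
Proof.
move=> nuP mE [qm qi qE [B [f [Bd fd phiE]]]].
exists B, f; split; [exact: Bd|exact: fd| |].
  exact: (mxdensity_unique (sandwich_density mE qi qE)
    (trace_deriv_density mE Bd fd)).
have /(povm_aeP _ nuP mE) := phiE; apply: filterS => x ->.
by rewrite sqrtmE ginvE.
Qed.

(** The scalar derivative f, the density B in the closed formula, and A2 satisfy
    A1^(1/2) phi A1^(1/2) = f B = f A2, because the three are densities of nu2 with
    respect to the trace measure of nu1.  Hence phi lives on the range of A1, and
    the square root S in [boxtimesE] is f^(1/2) A2^(1/2).  Undoing the compression
    by A1^(1/2) then leaves f A2^(1/2) psi A2^(1/2): the product is arranged so
    that integrating it against nu1 is integrating psi against nu2. *)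
Lemma boxtimes_ae nu1 nu2 (m : {finite_measure set T -> \bar R}) A1 A2 phi :
  is_povm T nu1 -> (m : set T -> \bar R) = trace_measure T nu1 ->
  (forall x, psdmx (A1 x)) -> is_density T nu2 A2 ->
  is_qRN T nu1 A1 nu2 phi -> (forall x, psdmx (phi x)) ->
  exists2 f : T -> R, is_trace_deriv T nu1 nu2 f &
    \forall x \ae m, forall psi,
      boxtimes A1 phi psi x = compress (A1 x) ((f x)%:C *: sandwich A2 psi x) /\
      sandwich A1 (boxtimes A1 phi psi) x = (f x)%:C *: sandwich A2 psi x.
Proof.
move=> nuP mE A10 A2d phiRN phi0.
have [B [f [Bd fd sphi phiE]]] := qRN_ae nuP mE phiRN.
exists f => //.
have fB := trace_deriv_density mE Bd fd.
have fA2 := trace_deriv_density mE A2d fd.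
have BA2 := mxdensity_unique fB fA2.
have [A20 _ _ _] := A2d; have [f0 _ _] := fd.
have fC0 x : 0 <= (f x)%:C by rewrite lecR.
near=> x => psi.
have sphix : sandwich A1 phi x = (f x)%:C *: B x by near: x; exact: sphi.
have phix : phi x = (f x)%:C *: compress (A1 x) (B x) by near: x; exact: phiE.
have BA2x : (f x)%:C *: B x = (f x)%:C *: A2 x by near: x; exact: BA2.
have PqP : rangep (A1 x) *m phi x *m rangep (A1 x) = phi x.
  rewrite -(compress_sandwich _ (A10 x)) [RHS]phix /compress.
  by rewrite scalemxAl scalemxAr -sphix.
have [boxE boxE'] := boxtimesE psi (A10 x) (phi0 x) PqP.
have SE : sqrtmx (sqrtmx (A1 x) *m phi x *m sqrtmx (A1 x)) =
    sqrtC (f x)%:C *: sqrtmx (A2 x).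
  have -> : sqrtmx (A1 x) *m phi x *m sqrtmx (A1 x) = (f x)%:C *: A2 x.
    by rewrite -BA2x -sphix.
  exact: (sqrtmxZ (fC0 x) (A20 x : psdmx (A2 x))).
have SpS : sqrtC (f x)%:C *: sqrtmx (A2 x) *m psi x *m
    (sqrtC (f x)%:C *: sqrtmx (A2 x)) = (f x)%:C *: sandwich A2 psi x.
  by rewrite -!scalemxAl -scalemxAr scalerA -expr2 sqrtCK.
rewrite SE SpS in boxE boxE'.
by split; [exact: boxE|rewrite /sandwich boxE; exact: boxE'].
Unshelve. all: by end_near. Qed.

End absolutely_continuous_pairs.

(** * Restriction to F and the theorem *)

Section sub_sigma_algebra.
Context {R : realType} {X : ptopologicalType} {d : nat}.
Variable F : set (set X).
Hypothesis F_sub : F `<=` <<s @open X >>.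

Lemma measurable_sub (E : set X) :
  measurable (E : set (g_sigma_algebraType F)) ->
  measurable (E : set (Borel X)).
Proof.
have sub := @smallest_sub _ (sigma_algebra [set: X]) F <<s @open X >>
  (smallest_sigma_algebra _ _) F_sub.
exact: (sub E).
Qed.

Lemma is_povm_sub (nu : set X -> 'M[R[i]]_d) : is_povm (Borel X) nu ->
  is_povm (g_sigma_algebraType F) nu.
Proof.
move=> [nu0 nuT nus]; split=> // [E mE|E mE tE rho].
  by apply: nu0; exact: measurable_sub.
by apply: nus => // k; exact: measurable_sub.
Qed.

Lemma povm_ac_sub (nu nu' : set X -> 'M[R[i]]_d) : povm_ac (Borel X) nu nu' ->
  povm_ac (g_sigma_algebraType F) nu nu'.
Proof. by move=> ac E mE; apply: ac; exact: measurable_sub. Qed.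

End sub_sigma_algebra.

Theorem mainTheorem6 (R : realType) (X : ptopologicalType) (d : nat)
  (X_lc : locally_compact [set: X]) (X_T2 : hausdorff_space X)
  (nu1 nu2 : set X -> 'M[R[i]]_d)
  (nu1_povm : is_povm1 (Borel X) nu1) (nu2_povm : is_povm1 (Borel X) nu2)
  (nu21 : povm_ac (Borel X) nu2 nu1) (nu12 : povm_ac (Borel X) nu1 nu2)
  (* versions of dnu1/dmu1, dnu2/dmu2 and of dnu2/dnu1 *)
  (A1 A2 phi : X -> 'M[R[i]]_d)
  (hA1 : is_density (Borel X) nu1 A1) (hA2 : is_density (Borel X) nu2 A2)
  (hphi : is_qRN (Borel X) nu1 A1 nu2 phi) (phi_ge0 : forall x, psd (phi x))
  (psi : X -> 'M[R[i]]_d)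
  (psi_ge0 : forall x, psd (psi x)) (psi_meas : qmeasurable (Borel X) psi)
  (psi_int : qintegrable (Borel X) nu2 A2 psi)
  (psi_neq0 : qexp (Borel X) nu2 A2 psi <> 0)
  (F : set (set X)) (F_sigma : sigma_algebra [set: X] F)
  (F_sub : F `<=` <<s @open X >>)
  (* versions of dnu1'/dmu1' and dnu2'/dmu2' on (X, F) *)
  (A1' A2' : X -> 'M[R[i]]_d)
  (hA1' : is_density (g_sigma_algebraType F) nu1 A1')
  (hA2' : is_density (g_sigma_algebraType F) nu2 A2')
  (* phi' = E_nu1[dnu2/dnu1 | F] = dnu2'/dnu1' and eta = E_nu2[psi | F] *)
  (phi' eta : X -> 'M[R[i]]_d)
  (hphi' : is_qcondexp F nu1 A1 A1' phi phi')
  (phi'_ge0 : forall x, psd (phi' x))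
  (heta : is_qcondexp F nu2 A2 A2' psi eta) :
  (exists zeta, is_qcondexp F nu1 A1 A1' (boxtimes A1 phi psi) zeta) /\
  forall zeta, is_qcondexp F nu1 A1 A1' (boxtimes A1 phi psi) zeta ->
    povm_ae (g_sigma_algebraType F) nu1
      (fun x => boxtimes A1' phi' eta x = zeta x).
Proof.
have [[nu1P _] [nu2P _]] := (nu1_povm, nu2_povm).
have [A1_ge0 A1m _ _] := hA1; have [A2_ge0 A2m _ _] := hA2.
have [phi_meas _ phiE _] := hphi.
pose kappa E := qintegral (Borel X) nu2 A2 E psi.
pose box := boxtimes A1 phi psi.
have [m1 m1E] := povm_finite_measure nu1P.
have [m2 m2E] := povm_finite_measure nu2P.
have [f fd boxae] := boxtimes_ae nu1P m1E A1_ge0 hA2 hphi phi_ge0.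
have psi_dens : mxdensity m2 (sandwich A2 psi) kappa.
  exact: (sandwich_density m2E psi_int (fun E _ => erefl)).
have A1mm : @mxmeas R _ (Borel X) d d A1 by exact/qmeasurableP.
have psim : @mxmeas R _ (Borel X) d d psi by exact/qmeasurableP.
have phim : @mxmeas R _ (Borel X) d d phi by exact/qmeasurableP.
have box_meas := mxmeas_boxtimes A1_ge0 phi_ge0 A1mm phim psim.
(* The quantum integrals of boxtimes against nu1 and of psi against nu2 agree on
   the Borel sets: both have the density f A2^(1/2) psi A2^(1/2). *)
have box_dens : mxdensity m1 (sandwich A1 box) kappa.
  apply: (mxdensity_ae (mxmeas_sandwich A1_ge0 A1mm box_meas)
    (mxdensity_change m1E m2E fd psi_dens)).
  by apply: filterS boxae => x /(_ psi)[].
have [box_int boxI] := box_dens.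
have box_qint : qintegrable (Borel X) nu1 A1 box by exact/(qintegrableP m1E).
have box_kappa E : measurable (E : set (Borel X)) ->
    qintegral (Borel X) nu1 A1 E box = kappa E.
  by move=> mE; rewrite (qintegralE m1E mE box_int) (boxI _ mE).
have box_neq0 : qexp (Borel X) nu1 A1 box <> 0.
  have [psi_i psiI] := psi_dens.
  have psi_exp := etrans (qexpE m2E psi_i) (esym (psiI setT measurableT)).
  have box_exp := etrans (qexpE m1E box_int) (esym (boxI setT measurableT)).
  by rewrite box_exp -psi_exp.
have box_psd x : psd (box x).
  exact: (boxtimes_psd (A1_ge0 x) (phi_ge0 x) (psi_ge0 x)).
have condexpP zeta : is_qcondexp F nu1 A1 A1' box zeta <->
    is_qRN (g_sigma_algebraType F) nu1 A1' kappa zeta.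
  have kE E : measurable (E : set (g_sigma_algebraType F)) ->
      qintegral (Borel X) nu1 A1 E box = kappa E.
    by move=> mE; apply: box_kappa; exact: measurable_sub mE.
  split=> [[_ _ _ _]|zRN]; first exact: is_qRN_eq.
  split; [exact: box_psd|exact/qmeasurableP|exact: box_qint|exact: box_neq0|].
  by apply: is_qRN_eq zRN => E mE; rewrite kE.
have [A1'_ge0 A1'm _ _] := hA1'.
have nu1P' := is_povm_sub F_sub nu1P.
have nu2P' := is_povm_sub F_sub nu2P.
have [m1' m1'E] := povm_finite_measure nu1P'.
have [m2' m2'E] := povm_finite_measure nu2P'.
(* The averaged derivative phi' is the derivative of nu2 restricted to F, so the
   pointwise formula applies over F as well. *)
have phi'RN : is_qRN (g_sigma_algebraType F) nu1 A1' nu2 phi'.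
  have [_ _ _ _] := hphi'; apply: is_qRN_eq => E mE.
  by rewrite -phiE//; exact: measurable_sub mE.
have [f' f'd box'ae] := boxtimes_ae nu1P' m1'E A1'_ge0 hA2' phi'RN phi'_ge0.
have [_ _ _ _ etaRN] := heta.
have [B [g [Bd gd etaE _]]] := qRN_ae nu2P' m2'E etaRN.
(* The identity holds outside a null set of nu2, and null sets of nu2 are null
   sets of nu1. *)
have etaE1 : \forall x \ae m1', sandwich A2' eta x = (g x)%:C *: B x.
  apply/(povm_aeP _ nu1P' m1'E)/(povm_ae_ac (povm_ac_sub F_sub nu12)).
  exact/(povm_aeP _ nu2P' m2'E).
(* Chain rule for the scalar derivatives. *)
pose h x := f' x * g x.
have hd : is_trace_deriv (g_sigma_algebraType F) nu1 kappa h.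
  have [f'0 f'm f'E] := f'd; have [g0 gm gE] := gd.
  split=> [x||E mE]; [exact: mulr_ge0|exact: measurable_funM|].
  have f'E' E' : measurable E' -> m2' E' = (\int[m1']_(x in E') (f' x)%:E)%E.
    by move=> mE'; rewrite m1'E m2'E f'E.
  by rewrite gE// -m2'E -m1'E (density_ge0_integral f'm f'E' g0 mE gm).
have hB := trace_deriv_density m1'E Bd hd.
(* The closed formula for the derivative of kappa with respect to nu1 over F. *)
pose zeta0 x := (h x)%:C *: compress (A1' x) (B x).
have zeta0E x : zeta0 x =
    compress (A1' x) ((f' x)%:C *: ((g x)%:C *: B x)).
  by rewrite /zeta0 -compressZ scalerA -rmorphM.
have box'E : \forall x \ae m1', boxtimes A1' phi' eta x = zeta0 x.
  apply: filterS2 box'ae etaE1 => x /(_ eta)[-> _] ->.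
  by rewrite zeta0E.
have A1'mm : @mxmeas R _ (g_sigma_algebraType F) d d A1'.
  exact/qmeasurableP.
have zeta0_meas : @mxmeas R _ (g_sigma_algebraType F) d d zeta0.
  have [_ hm _] := hd; have [_ Bm _ _] := Bd.
  have Bmm : mxmeas B by exact/qmeasurableP.
  have hC : cmeasurable (fun x => (h x)%:C) by split=> //; exact: measurable_cst.
  exact: (mxmeasZ hC (mxmeas_compress A1'_ge0 A1'mm Bmm)).
have zeta0_dens : mxdensity m1' (sandwich A1' zeta0) kappa.
  apply: (mxdensity_ae (mxmeas_sandwich A1'_ge0 A1'mm zeta0_meas) hB).
  apply: filterS3 box'ae etaE1 box'E => x /(_ eta)[_ sE] eE zE.
  have -> : sandwich A1' zeta0 x = sandwich A1' (boxtimes A1' phi' eta) x.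
    by rewrite /sandwich zE.
  by rewrite sE eE scalerA -rmorphM.
have zeta0RN : is_qRN (g_sigma_algebraType F) nu1 A1' kappa zeta0.
  have [zi zI] := zeta0_dens.
  split; [exact/qmeasurableP|exact/(qintegrableP m1'E)| |].
    by move=> E mE; rewrite (qintegralE m1'E mE zi) (zI _ mE).
  exists B, h; split; [exact: Bd|exact: hd|apply/(povm_aeP _ nu1P' m1'E)].
  by apply: aeW => x; rewrite sqrtmE ginvE.
split; first by exists zeta0; apply/condexpP.
move=> zeta /condexpP zetaRN; apply/(povm_aeP _ nu1P' m1'E).
have [B2 [h2 [B2d h2d _ zetaE]]] := qRN_ae nu1P' m1'E zetaRN.
(* Two versions may differ in the density B and in the scalar derivative h, but the
   product h B is a density of kappa, hence unique. *)
have BB2 := mxdensity_unique hB (trace_deriv_density m1'E B2d h2d).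
near=> x.
have bE : boxtimes A1' phi' eta x = zeta0 x by near: x; exact: box'E.
have zE : zeta x = (h2 x)%:C *: compress (A1' x) (B2 x) by near: x; exact: zetaE.
have e : (h x)%:C *: B x = (h2 x)%:C *: B2 x by near: x; exact: BB2.
by rewrite bE zE /zeta0 -!compressZ e.
Unshelve. all: by end_near. Qed.
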